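(* Let $f(z)=z+\sum_{n=2}^{\infty}a_nz^n$ belong to $\mathcal{S}^*_{ch}$, and let $\gamma_1,\gamma_2,\gamma_3$ be its first three logarithmic coefficients, i.e. $$\gamma_1=\tfrac12 a_2,\qquad \gamma_2=\tfrac12\Big(a_3-\tfrac12 a_2^2\Big),\qquad \gamma_3=\tfrac12\Big(a_4-a_2a_3+\tfrac13 a_2^3\Big).$$ Then $|\gamma_n|\le \frac{1}{2n}$ for $n=1,2,3$. These inequalities are sharp: for each $n\in\{1,2,3\}$, equality $|\gamma_n|=\frac1{2n}$ holds for the function $$f_n(z)=z\exp\left(\int_0^z\frac{t^n+\cosh(t^n)-1}{t}\,dt\right),\quad z\in\mathbb{D},$$ which belongs to $\mathcal{S}^*_{ch}$.
   Context: $\mathbb{D}=\{z\in\mathbb{C}:|z|<1\}$. $\mathcal{A}$ is the class of analytic functions $f$ on $\mathbb{D}$ with $f(0)=0$, $f'(0)=1$, i.e. $f(z)=z+\sum_{n\ge2}a_nz^n$. For analytic $g,h$ on $\mathbb{D}$, $g\prec h$ (subordination) means there is an analytic $\omega$ on $\mathbb{D}$ with $\omega(0)=0$, $|\omega(z)|<1$, and $g=h\circ\omega$. The class $\mathcal{S}^*_{ch}$ consists of all $f\in\mathcal{A}$ with $\frac{zf'(z)}{f(z)}\prec \varphi_0(z):=z+\cosh z$ on $\mathbb{D}$. The logarithmic coefficients $\gamma_n$ of $f$ are defined by $\log\frac{f(z)}{z}=2\sum_{n\ge1}\gamma_nz^n$ (with $\log 1=0$); the formulas for $\gamma_1,\gamma_2,\gamma_3$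 in terms of $a_2,a_3,a_4$ follow from this definition. *)

(* Defs.v *)
From Stdlib Require Import Reals.
From Coquelicot Require Import Coquelicot.

Open Scope R_scope.

Definition in_disk (z : C) : Prop := Cmod z < 1.

Definition cexp (z : C) : C :=
  (exp (Re z) * cos (Im z), exp (Re z) * sin (Im z)).
Definition ccosh (z : C) : C := ((cexp z + cexp (- z)) / 2)%C.

Definition is_cderiv (f : C -> C) (z d : C) : Prop :=
  @is_derive C_AbsRing C_NormedModule f z d.

Definition taylor_on_disk (f : C -> C) (a : nat -> C) : Prop :=
  forall z : C, in_disk z -> is_pseries a z (f z).

(* Analytic on D (a function analytic on the disk |z|<1 is exactly one
   represented there by its Maclaurin series). *)
Definition analytic_on_disk (f : C -> C) : Prop :=
  exists a : nat -> C, taylor_on_disk f a.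

Definition classA (f : C -> C) : Prop :=
  analytic_on_disk f /\ f 0%C = 0%C /\ is_cderiv f 0%C 1%C.

Definition schwarz (w : C -> C) : Prop :=
  analytic_on_disk w /\ w 0%C = 0%C /\ (forall z, in_disk z -> in_disk (w z)).

Definition phi0 (z : C) : C := (z + ccosh z)%C.

(* S*_ch : f in A with z f'(z)/f(z) subordinate to phi_0 on D, i.e. there is
   a Schwarz function w with z f'(z)/f(z) = phi_0(w(z)) on D.  At z = 0 the
   quotient z f'/f is (by removability) 1 = phi_0(w(0)), so the identity is
   imposed for z <> 0, where f(z) <> 0 is also required so that the
   quotient is defined. *)
Definition starlike_ch (f : C -> C) : Prop :=
  classA f /\
  exists w : C -> C, schwarz w /\
    forall z : C, in_disk z -> z <> 0%C ->
      f z <> 0%C /\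
      exists d : C, is_cderiv f z d /\ (z * d / f z)%C = phi0 (w z).

Definition log_coeff (a : nat -> C) (n : nat) : C :=
  match n with
  | 1%nat => (a 2%nat / 2)%C
  | 2%nat => ((a 3%nat - a 2%nat * a 2%nat / 2) / 2)%C
  | 3%nat => ((a 4%nat - a 2%nat * a 3%nat
               + a 2%nat * a 2%nat * a 2%nat / 3) / 2)%C
  | _ => 0%C
  end.

Definition g_ext (n : nat) (t : C) : C :=
  ((Cpow t n + ccosh (Cpow t n) - 1) / t)%C.

(* Integral from 0 to z along the segment [0,z]:
   int_0^z g(t) dt = int_0^1 g(s z) z ds  (Riemann integral, C-valued). *)
Definition seg_int (g : C -> C) (z : C) : C :=
  @RInt C_R_CompleteNormedModule (fun s : R => (g (RtoC s * z) * z)%C) 0 1.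

Definition f_ext (n : nat) (z : C) : C :=
  (z * cexp (seg_int (g_ext n) z))%C.

(* Main.v *)
(** If [w = c1 z + c2 z^2 + ...] is the Schwarz function with
    [z f'/f = phi0 (w)], comparing coefficients gives [2 gamma_1 = c1],
    [4 gamma_2 = c2 + c1^2 / 2] and [6 gamma_3 = c3 + c1 c2].  These are
    coefficients of [w (1 + mu c1 z)] for [mu = 0, 1/2, 1], and since
    [|w (1 + mu c1 z)| <= |1 + mu c1 z|] on the disk, Parseval's inequality yields
      [|c1|^2 + |c2 + mu c1^2|^2 + |c3 + mu c1 c2|^2 <= 1 + mu^2 |c1|^2],
    which bounds each of the three quantities by 1.

    For the extremal functions [w = z^n].  The coefficients [e_k] of
    [exp (int_0^z g)] with [g = (phi0 (z^n) - 1) / z] satisfy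
    [(k+1) e_(k+1) = sum_(i <= k) g_i e_(k-i)] with [|g_i| <= 1], so [|e_k| <= 1]
    by induction and the power series converges on the disk. *)

Require Import Defs.
From Stdlib Require Import Reals Lra Lia Factorial Arith.
From Coquelicot Require Import Coquelicot.

(** * Complex series and power series on the disk *)

(** The multiplier [1 + mu c1 z] is cheap because its mean square on the unit circle is exactly
    [1 + mu^2 |c1|^2]; for [0 <= mu <= 1] the excess is absorbed by the term [|c1|^2] on the left.
    Comparing coefficients would call for the series of the composition [phi0 (w z)]. Instead [phi0]
    is replaced by [1 + w + w^2 / 2], with an error [O(w^4)] because the cubic coefficient of [phi0]
    vanishes; an analytic function that is [O(z^5)] at 0 has zero coefficients below index 5.
    Parseval is obtained without integrals: it is an exact identity for polynomials sampled at roots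
    of unity, extended by uniform approximation on [|z| = r] and then by [r -> 1]. No complex
    logarithm occurs either. A solution of [E' = g E] is recognized as [exp G] with [G' = g] because
    [E exp (- G)] has derivative zero. This one argument identifies both the exponential series and
    the extremal functions. *)

Definition Csum (u : nat -> C) (n : nat) : C := @sum_n C_AbsRing u n.

Lemma Csum_0 (u : nat -> C) : Csum u 0 = u 0%nat.
Proof. apply (sum_O (G := C_AbelianMonoid)). Qed.

Lemma Csum_S (u : nat -> C) (n : nat) : Csum u (S n) = (Csum u n + u (S n))%C.
Proof. apply (sum_Sn (G := C_AbelianMonoid)). Qed.

Lemma Csum_ext (u v : nat -> C) (n : nat) :
  (forall k, u k = v k) -> Csum u n = Csum v n.
Proof. apply (sum_n_ext (G := C_AbelianMonoid)). Qed.

Lemma Csum_plus (u v : nat -> C) (n : nat) :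
  Csum (fun k => u k + v k)%C n = (Csum u n + Csum v n)%C.
Proof. apply (sum_n_plus (G := C_AbelianMonoid)). Qed.

Lemma Csum_scal (x : C) (u : nat -> C) (n : nat) :
  Csum (fun k => x * u k)%C n = (x * Csum u n)%C.
Proof. apply (sum_n_mult_l (K := C_Ring)). Qed.

Definition csum (u : nat -> C) (l : C) : Prop :=
  @is_series C_AbsRing C_NormedModule u l.

Lemma csum_eps (u : nat -> C) (l : C) :
  csum u l <->
  forall eps : R, 0 < eps -> exists N : nat, forall n : nat, (N <= n)%nat ->
    Cmod (Csum u n - l)%C < eps.
Proof.
  unfold csum, is_series.
  split.
  - intros H eps He.
    destruct (proj1 (filterlim_locally_ball_norm (U := C_NormedModule) _ _) H
                (mkposreal eps He)) as [N HN].
    exists N. intros n Hn. exact (HN n Hn).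
  - intros H. apply (filterlim_locally_ball_norm (U := C_NormedModule)).
    intros eps. destruct (H eps (cond_pos eps)) as [N HN].
    exists N. intros n Hn. exact (HN n Hn).
Qed.

Lemma csum_ext (u v : nat -> C) (l : C) :
  (forall n, u n = v n) -> csum u l -> csum v l.
Proof. exact (is_series_ext (V := C_NormedModule) u v l). Qed.

Lemma csum_plus (u v : nat -> C) (k l : C) :
  csum u k -> csum v l -> csum (fun n => u n + v n)%C (k + l)%C.
Proof. exact (is_series_plus (V := C_NormedModule) u v k l). Qed.

Lemma csum_minus (u v : nat -> C) (k l : C) :
  csum u k -> csum v l -> csum (fun n => u n - v n)%C (k - l)%C.
Proof. exact (is_series_minus (V := C_NormedModule) u v k l). Qed.

Lemma csum_scal (c : C) (u : nat -> C) (l : C) :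
  csum u l -> csum (fun n => c * u n)%C (c * l)%C.
Proof. exact (is_series_scal (V := C_NormedModule) c u l). Qed.

Lemma csum_shift (u : nat -> C) (l : C) :
  csum u l <-> csum (fun n => u (S n)) (l - u 0%nat)%C.
Proof.
  split; intros H.
  - apply (is_series_incr_1 (V := C_NormedModule) u).
    change (csum u (l - u 0%nat + u 0%nat)%C).
    now replace (l - u 0%nat + u 0%nat)%C with l by ring.
  - apply (is_series_decr_1 (V := C_NormedModule) u). exact H.
Qed.

Lemma csum_unique (u : nat -> C) (k l : C) : csum u k -> csum u l -> k = l.
Proof.
  intros Hk Hl.
  exact (filterlim_locally_unique (V := C_NormedModule) _ _ _ Hk Hl).
Qed.

Lemma Cmod_le_abs (z : C) : Cmod z <= Rabs (Re z) + Rabs (Im z).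
Proof.
  destruct z as [x y]. unfold Re, Im; simpl fst; simpl snd.
  replace (x, y) with (RtoC x + Ci * RtoC y)%C
    by (unfold RtoC, Ci, Cplus, Cmult; simpl; f_equal; ring).
  eapply Rle_trans; [apply Cmod_triangle|].
  rewrite Cmod_mult, Cmod_Ci, !Cmod_R. lra.
Qed.

Lemma im_le_Cmod (z : C) : Rabs (Im z) <= Cmod z.
Proof. eapply Rle_trans; [apply Rmax_r | apply Rmax_Cmod]. Qed.

Lemma Re_Csum (u : nat -> C) (n : nat) :
  Re (Csum u n) = sum_n (fun k => Re (u k)) n.
Proof.
  induction n as [|n IH]; [now rewrite Csum_0, sum_O|].
  rewrite Csum_S, sum_Sn, <- IH. reflexivity.
Qed.

Lemma Im_Csum (u : nat -> C) (n : nat) :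
  Im (Csum u n) = sum_n (fun k => Im (u k)) n.
Proof.
  induction n as [|n IH]; [now rewrite Csum_0, sum_O|].
  rewrite Csum_S, sum_Sn, <- IH. reflexivity.
Qed.

Lemma is_series_R_eps (u : nat -> R) (l : R) :
  is_series u l <->
  forall eps : R, 0 < eps -> exists N : nat, forall n : nat, (N <= n)%nat ->
    Rabs (sum_n u n - l) < eps.
Proof.
  unfold is_series. split.
  - intros H eps He.
    destruct (proj1 (filterlim_locally _ _) H (mkposreal eps He)) as [N HN].
    exists N. intros n Hn. exact (HN n Hn).
  - intros H. apply filterlim_locally. intros eps.
    destruct (H eps (cond_pos eps)) as [N HN].
    exists N. intros n Hn. exact (HN n Hn).
Qed.

(** Lets results on real series, such as the Cauchy product and the total function [Series], be used
    over [C]. *)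
Lemma csum_Re_Im (u : nat -> C) (l : C) :
  csum u l <->
  is_series (fun n => Re (u n)) (Re l) /\ is_series (fun n => Im (u n)) (Im l).
Proof.
  rewrite csum_eps, !is_series_R_eps. split.
  - intros H. split; intros eps He; destruct (H eps He) as [N HN];
      exists N; intros n Hn; eapply Rle_lt_trans; [| apply (HN n Hn) | | apply (HN n Hn)].
    + rewrite <- Re_Csum. apply (re_le_Cmod (_ - _)%C).
    + rewrite <- Im_Csum. apply (im_le_Cmod (_ - _)%C).
  - intros [H1 H2] eps He.
    destruct (H1 (eps / 2)) as [N1 HN1]; [lra|].
    destruct (H2 (eps / 2)) as [N2 HN2]; [lra|].
    exists (max N1 N2). intros n Hn.
    specialize (HN1 n ltac:(lia)). specialize (HN2 n ltac:(lia)).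
    rewrite <- Re_Csum in HN1. rewrite <- Im_Csum in HN2.
    eapply Rle_lt_trans; [apply Cmod_le_abs|].
    change (Rabs (Re (Csum u n) - Re l)
            + Rabs (Im (Csum u n) - Im l) < eps). lra.
Qed.

Lemma ex_csum_abs (u : nat -> C) (v : nat -> R) :
  (forall n, Cmod (u n) <= v n) -> ex_series v -> exists l, csum u l.
Proof.
  intros H Hv.
  exact (ex_series_le (V := C_CompleteNormedModule) u v H Hv).
Qed.

Lemma Cmod_Csum_le (u : nat -> C) (v : nat -> R) (n : nat) :
  (forall k, Cmod (u k) <= v k) ->
  Cmod (Csum u n) <= sum_n v n.
Proof.
  intros H. induction n as [|n IH].
  - rewrite Csum_0, sum_O. apply H.
  - rewrite Csum_S, sum_Sn. eapply Rle_trans; [apply Cmod_triangle|].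
    apply Rplus_le_compat; [exact IH | apply H].
Qed.

Lemma csum_Cmod_le (u : nat -> C) (v : nat -> R) (l : C) (m : R) :
  (forall n, Cmod (u n) <= v n) -> csum u l -> is_series v m -> Cmod l <= m.
Proof.
  intros H Hu Hv.
  apply le_epsilon. intros eps He.
  destruct (proj1 (csum_eps _ _) Hu (eps / 2)) as [N1 HN1]; [lra|].
  destruct (proj1 (is_series_R_eps _ _) Hv (eps / 2)) as [N2 HN2]; [lra|].
  specialize (HN1 (max N1 N2) ltac:(lia)). specialize (HN2 (max N1 N2) ltac:(lia)).
  pose proof (Cmod_Csum_le u v (max N1 N2) H) as HS.
  apply Rabs_def2 in HN2.
  set (s := Csum u (max N1 N2)) in *.
  replace l with (s + - (s - l))%C by ring.
  eapply Rle_trans; [apply Cmod_triangle|]. rewrite Cmod_opp. lra.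
Qed.

Lemma taylor_csum (f : C -> C) (a : nat -> C) :
  taylor_on_disk f a <->
  forall z, in_disk z -> csum (fun n => a n * z ^ n)%C (f z).
Proof.
  assert (E : forall z n, (@scal C_AbsRing C_NormedModule (pow_n z n) (a n)
                           = a n * z ^ n)%C).
  { intros z n. change (@pow_n C_AbsRing z n * a n = a n * z ^ n)%C.
    replace (@pow_n C_AbsRing z n) with (z ^ n)%C; [ring|].
    induction n as [|n IH]; simpl; [reflexivity | now rewrite IH]. }
  split; intros H z Hz.
  - eapply csum_ext; [intros n; apply E | apply (H z Hz)].
  - eapply csum_ext; [intros n; symmetry; apply E | apply (H z Hz)].
Qed.

Lemma taylor_ext (f g : C -> C) (a b : nat -> C) :
  (forall z, in_disk z -> f z = g z) -> (forall n, a n = b n) ->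
  taylor_on_disk f a -> taylor_on_disk g b.
Proof.
  rewrite !taylor_csum. intros Hf Ha H z Hz. rewrite <- Hf by assumption.
  eapply csum_ext; [|apply H, Hz]. intros n; simpl. now rewrite Ha.
Qed.

Lemma in_disk_RtoC (r : R) : 0 <= r < 1 -> in_disk r.
Proof. intros H. unfold in_disk. rewrite Cmod_R, Rabs_pos_eq; lra. Qed.

(** Convergence at the midpoint [s] of [r] and 1 bounds the terms [|a_n| s^n], so the real series
    with coefficients [|a_n|] has radius at least [s > r]. From here on absolute convergence is a
    matter of real power series. *)
Lemma taylor_radius (f : C -> C) (a : nat -> C) (r : R) :
  taylor_on_disk f a -> 0 <= r < 1 ->
  Rbar_lt (Rabs r) (CV_radius (fun n => Cmod (a n))).
Proof.
  intros H Hr. set (s := (1 + r) / 2).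
  assert (Hs : 0 <= s < 1) by (unfold s; lra).
  apply Rbar_lt_le_trans with s; [rewrite Rabs_pos_eq by lra; unfold s; simpl; lra|].
  apply CV_radius_bounded.
  pose proof (proj1 (taylor_csum f a) H s (in_disk_RtoC s Hs)) as Hsum.
  destruct (filterlim_bounded (V := C_NormedModule) _ (ex_intro _ _ Hsum)) as [M HM].
  (* A term is the difference of two consecutive partial sums, each bounded by [M]. *)
  exists (2 * M). intros n.
  assert (E : Rabs (Cmod (a n) * s ^ n) = Cmod (a n * s ^ n)%C).
  { rewrite Cmod_mult, Cmod_pow, Cmod_R, (Rabs_pos_eq s) by lra.
    apply Rabs_pos_eq. apply Rmult_le_pos; [apply Cmod_ge_0 | apply pow_le; lra]. }
  rewrite E. destruct n as [|n].
  - specialize (HM 0%nat).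
    change (Cmod (Csum (fun n => a n * s ^ n)%C 0) <= M) in HM. rewrite Csum_0 in HM.
    pose proof (Cmod_ge_0 (a 0%nat * s ^ 0)%C). lra.
  - pose proof (HM n) as H1. pose proof (HM (S n)) as H2.
    change (Cmod (Csum (fun n => a n * s ^ n)%C n) <= M) in H1.
    change (Cmod (Csum (fun n => a n * s ^ n)%C (S n)) <= M) in H2.
    rewrite Csum_S in H2. set (t := Csum (fun n => a n * s ^ n)%C n) in *.
    replace (a (S n) * s ^ S n)%C with ((t + a (S n) * s ^ (S n)) + - t)%C by ring.
    eapply Rle_trans; [apply Cmod_triangle|]. rewrite Cmod_opp. lra.
Qed.

Lemma taylor_abs (f : C -> C) (a : nat -> C) (r : R) :
  taylor_on_disk f a -> 0 <= r < 1 -> ex_series (fun n => Cmod (a n) * r ^ n).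
Proof.
  intros H Hr. apply ex_series_Rabs.
  apply CV_disk_inside, (taylor_radius f); assumption.
Qed.

(** * Termwise differentiation of power series *)

Lemma Cpow_diff_bound (z h : C) (rho : R) (n : nat) :
  Cmod z <= rho -> Cmod (z + h)%C <= rho ->
  Cmod ((z + h) ^ S n - z ^ S n)%C <= INR (S n) * rho ^ n * Cmod h.
Proof.
  intros Hz Hh. pose proof (Cmod_ge_0 z). pose proof (Cmod_ge_0 h).
  induction n as [|n IH].
  - replace ((z + h) ^ 1 - z ^ 1)%C with h by (simpl; ring). simpl; lra.
  - replace ((z + h) ^ S (S n) - z ^ S (S n))%C
      with (z * ((z + h) ^ S n - z ^ S n) + h * (z + h) ^ S n)%C
      by (rewrite !Cpow_S; ring).
    eapply Rle_trans; [apply Cmod_triangle|]. rewrite !Cmod_mult, Cmod_pow.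
    assert (H1 : Cmod z * Cmod ((z + h) ^ S n - z ^ S n)%C
                 <= rho * (INR (S n) * rho ^ n * Cmod h))
      by (apply Rmult_le_compat; auto using Cmod_ge_0).
    assert (H2 : Cmod h * Cmod (z + h)%C ^ S n <= Cmod h * rho ^ S n)
      by (apply Rmult_le_compat_l; auto; apply pow_incr; split; auto using Cmod_ge_0).
    rewrite (S_INR (S n)). simpl pow in *. nra.
Qed.

(** Second-order Taylor remainder of a power, uniform for [z] and [z + h] in the disk of radius
    [rho]. The usual factor 1/2 is dropped so that the constant is exactly the factor produced by
    differentiating twice, matching [PS_derive (PS_derive A)] below. *)
Lemma Cpow_diff2_bound (z h : C) (rho : R) (n : nat) :
  Cmod z <= rho -> Cmod (z + h)%C <= rho ->
  Cmod ((z + h) ^ S (S n) - z ^ S (S n) - INR (S (S n)) * z ^ S n * h)%C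
  <= INR (S n) * INR (S (S n)) * rho ^ n * Cmod h ^ 2.
Proof.
  intros Hz Hh. pose proof (Cmod_ge_0 z). pose proof (Cmod_ge_0 h).
  induction n as [|n IH].
  - replace ((z + h) ^ 2 - z ^ 2 - INR 2 * z ^ 1 * h)%C with (h * h)%C
      by (simpl; rewrite RtoC_plus; ring).
    rewrite Cmod_mult. simpl. nra.
  - replace ((z + h) ^ S (S (S n)) - z ^ S (S (S n)) - INR (S (S (S n))) * z ^ S (S n) * h)%C
      with (z * ((z + h) ^ S (S n) - z ^ S (S n) - INR (S (S n)) * z ^ S n * h)
            + h * ((z + h) ^ S (S n) - z ^ S (S n)))%C
      by (rewrite (S_INR (S (S n))), RtoC_plus, !Cpow_S; ring).
    eapply Rle_trans; [apply Cmod_triangle|]. rewrite !Cmod_mult.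
    assert (H1 := Rmult_le_compat _ _ _ _ (Cmod_ge_0 z) (Cmod_ge_0 _) Hz IH).
    assert (H2 := Rmult_le_compat_l _ _ _ H0 (Cpow_diff_bound z h rho (S n) Hz Hh)).
    eapply Rle_trans; [apply (Rplus_le_compat _ _ _ _ H1 H2)|].
    rewrite (S_INR (S (S n))), (S_INR (S n)).
    assert (0 <= rho ^ S n * Cmod h ^ 2)
      by (apply Rmult_le_pos; apply pow_le; lra).
    pose proof (pos_INR (S n)). simpl pow in *. nra.
Qed.

Lemma is_cderiv_quadratic (f : C -> C) (z l : C) (delta M : R) :
  0 < delta ->
  (forall h, Cmod h < delta -> Cmod (f (z + h) - f z - h * l)%C <= M * Cmod h ^ 2) ->
  is_cderiv f z l.
Proof.
  intros Hd H. split.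
  - apply (is_linear_scal_l (V := C_NormedModule)).
  - intros x Hx.
    apply (is_filter_lim_locally_unique (V := AbsRing_NormedModule C_AbsRing)) in Hx.
    subst x. intros eps.
    assert (HM : 0 < Rabs M + 1) by (pose proof (Rabs_pos M); lra).
    (* The sign of [M] is unknown; [Rabs M + 1] is a positive bound for it. *)
    assert (Hp : 0 < Rmin delta (eps / (Rabs M + 1))).
    { apply Rmin_pos; [assumption|]. apply Rdiv_lt_0_compat; [apply cond_pos | assumption]. }
    apply (locally_le_locally_norm (V := AbsRing_NormedModule C_AbsRing)).
    exists (mkposreal _ Hp). intros y Hy.
    change (Cmod (y - z)%C < Rmin delta (eps / (Rabs M + 1))) in Hy.
    change (Cmod (f y - f z - (y - z) * l)%C <= eps * Cmod (y - z)%C).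
    set (h := (y - z)%C) in *.
    replace y with (z + h)%C by (unfold h; ring).
    eapply Rle_trans; [apply H|].
    + eapply Rlt_le_trans; [apply Hy | apply Rmin_l].
    + assert (Hh : Cmod h <= eps / (Rabs M + 1))
        by (eapply Rle_trans; [apply Rlt_le, Hy | apply Rmin_r]).
      apply (Rmult_le_compat_r (Rabs M + 1)) in Hh; [|lra].
      unfold Rdiv in Hh. rewrite Rmult_assoc, Rinv_l, Rmult_1_r in Hh by lra.
      pose proof (Cmod_ge_0 h). pose proof (Rle_abs M).
      simpl pow. nra.
Qed.

(** The remainder of the series is at most [|h|^2] times the second formal derivative of the series
    with coefficients [|a_n|], evaluated at [rho]. That sum is finite because formal differentiation
    preserves the radius of convergence. *)
Lemma taylor_derive_at (f : C -> C) (a : nat -> C) (z : C) :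
  taylor_on_disk f a -> in_disk z ->
  exists l, csum (fun n => INR (S n) * a (S n) * z ^ n)%C l /\ is_cderiv f z l.
Proof.
  intros H Hz. pose proof (proj1 (taylor_csum f a) H) as Hf.
  unfold in_disk in *. pose proof (Cmod_ge_0 z) as Hz0.
  (* A radius strictly between [|z|] and 1: increments with [|h| < rho - |z|] keep [z + h] in the
     disk of radius [rho]. *)
  set (rho := (1 + Cmod z) / 2).
  assert (Hrho : 0 <= rho < 1) by (unfold rho; lra).
  pose proof (taylor_radius f a rho H Hrho) as Hrad.
  set (A := fun n => Cmod (a n)) in *.
  assert (HA : forall n, 0 <= A n) by (intros; apply Cmod_ge_0).
  assert (S1 : ex_series (fun n => Rabs (PS_derive A n * rho ^ n))).
  { apply CV_disk_inside. now rewrite CV_radius_derive. }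
  assert (S2 : ex_series (fun n => Rabs (PS_derive (PS_derive A) n * rho ^ n))).
  { apply CV_disk_inside. now rewrite !CV_radius_derive. }
  assert (P1 : forall n, 0 <= PS_derive A n)
    by (intros n; apply Rmult_le_pos; [apply pos_INR | apply HA]).
  assert (P2 : forall n, 0 <= PS_derive (PS_derive A) n)
    by (intros n; apply Rmult_le_pos; [apply pos_INR | apply P1]).
  assert (Hpow : forall n, 0 <= rho ^ n) by (intros; apply pow_le; lra).
  assert (Hl : exists l, csum (fun n => INR (S n) * a (S n) * z ^ n)%C l).
  { refine (ex_csum_abs _ _ _ S1). intros n. rewrite Rabs_pos_eq by (apply Rmult_le_pos; auto).
    rewrite !Cmod_mult, Cmod_pow, Cmod_R, (Rabs_pos_eq (INR _)) by apply pos_INR.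
    apply Rmult_le_compat_l; [apply P1|].
    apply pow_incr. unfold rho; lra. }
  destruct Hl as [l Hl]. exists l. split; [exact Hl|].
  destruct S2 as [M HM].
  apply (is_cderiv_quadratic f z l (rho - Cmod z) M); [unfold rho; lra|].
  intros h Hh.
  assert (Hzh : Cmod (z + h)%C <= rho)
    by (eapply Rle_trans; [apply Cmod_triangle | lra]).
  (* The remainders of the terms of index 0 and 1 vanish, so two shifts make the sum start at index
     2, where the quadratic bound for powers applies. *)
  assert (Hsum : csum (fun n => a (S (S n)) *
      ((z + h) ^ S (S n) - z ^ S (S n) - INR (S (S n)) * z ^ S n * h))%C
      (f (z + h) - f z - h * l)%C).
  { pose proof (csum_minus _ _ _ _
       (Hf (z + h)%C ltac:(unfold in_disk; lra)) (Hf z Hz)) as K.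
    apply csum_shift in K.
    pose proof (csum_minus _ _ _ _ K (csum_scal h _ _ Hl)) as K2.
    apply csum_shift in K2. cbv beta in K2.
    eapply csum_ext; [|replace (f (z + h) - f z - h * l)%C with
      (f (z + h) - f z - (a 0%nat * (z + h) ^ 0 - a 0%nat * z ^ 0) - h * l -
       (a 1%nat * (z + h) ^ 1 - a 1%nat * z ^ 1 - h * (INR 1 * a 1%nat * z ^ 0)))%C
      by (simpl; ring); exact K2].
    intros n; cbv beta. ring. }
  rewrite Rmult_comm.
  refine (csum_Cmod_le _ _ _ _ _ Hsum
            (is_series_scal_l (V := R_NormedModule) (Cmod h ^ 2) _ _ HM)).
  intros n.
  change (Cmod (a (S (S n)) * ((z + h) ^ S (S n) - z ^ S (S n)
            - INR (S (S n)) * z ^ S n * h))%C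
          <= Cmod h ^ 2 * Rabs (PS_derive (PS_derive A) n * rho ^ n)).
  rewrite Rabs_pos_eq by (apply Rmult_le_pos; auto).
  rewrite Cmod_mult.
  eapply Rle_trans; [apply Rmult_le_compat_l;
     [apply Cmod_ge_0 | apply (Cpow_diff2_bound z h rho n); [unfold rho; lra | exact Hzh]]|].
  unfold PS_derive, A. right. ring.
Qed.

Lemma taylor_derive (f : C -> C) (a : nat -> C) :
  taylor_on_disk f a ->
  taylor_on_disk (C_derive f) (fun n => INR (S n) * a (S n))%C /\
  forall z, in_disk z -> is_cderiv f z (C_derive f z).
Proof.
  intros H. rewrite taylor_csum.
  split; intros z Hz; destruct (taylor_derive_at f a z H Hz) as [l [Hl Hd]];
    rewrite (is_C_derive_unique _ _ _ Hd); assumption.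
Qed.

(** * Products and orders of vanishing *)

Definition conv (a b : nat -> C) (n : nat) : C :=
  Csum (fun i => a i * b (n - i)%nat)%C n.

Lemma ex_series_Re (u : nat -> C) :
  ex_series (fun n => Cmod (u n)) -> ex_series (fun n => Rabs (Re (u n))).
Proof.
  apply (ex_series_le (V := R_CompleteNormedModule)). intros n.
  change (Rabs (Rabs (Re (u n))) <= Cmod (u n)).
  rewrite Rabs_Rabsolu. apply re_le_Cmod.
Qed.

Lemma ex_series_Im (u : nat -> C) :
  ex_series (fun n => Cmod (u n)) -> ex_series (fun n => Rabs (Im (u n))).
Proof.
  apply (ex_series_le (V := R_CompleteNormedModule)). intros n.
  change (Rabs (Rabs (Im (u n))) <= Cmod (u n)).
  rewrite Rabs_Rabsolu. apply im_le_Cmod.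
Qed.

(** Real Cauchy products of the real and imaginary parts, recombined: four products of absolutely
    convergent real series. *)
Lemma csum_mult (u v : nat -> C) (k l : C) :
  csum u k -> csum v l ->
  ex_series (fun n => Cmod (u n)) -> ex_series (fun n => Cmod (v n)) ->
  csum (conv u v) (k * l)%C.
Proof.
  intros Hu Hv Au Av.
  apply csum_Re_Im in Hu. apply csum_Re_Im in Hv.
  destruct Hu as [Hu1 Hu2], Hv as [Hv1 Hv2].
  pose proof (ex_series_Re u Au) as U1. pose proof (ex_series_Im u Au) as U2.
  pose proof (ex_series_Re v Av) as V1. pose proof (ex_series_Im v Av) as V2.
  apply csum_Re_Im. split.
  - refine (is_series_ext _ _ _ _ (is_series_minus _ _ _ _
      (is_series_mult _ _ _ _ Hu1 Hv1 U1 V1) (is_series_mult _ _ _ _ Hu2 Hv2 U2 V2))).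
    intros n. unfold conv. rewrite Re_Csum, sum_n_Reals.
    change (sum_f_R0 (fun k0 => Re (u k0) * Re (v (n - k0)%nat)) n
      - sum_f_R0 (fun k0 => Im (u k0) * Im (v (n - k0)%nat)) n =
      sum_f_R0 (fun k0 => Re (u k0 * v (n - k0)%nat)%C) n).
    rewrite <- minus_sum. reflexivity.
  - refine (is_series_ext _ _ _ _ (is_series_plus _ _ _ _
      (is_series_mult _ _ _ _ Hu1 Hv2 U1 V2) (is_series_mult _ _ _ _ Hu2 Hv1 U2 V1))).
    intros n. unfold conv. rewrite Im_Csum, sum_n_Reals.
    change (sum_f_R0 (fun k0 => Re (u k0) * Im (v (n - k0)%nat)) n
      + sum_f_R0 (fun k0 => Im (u k0) * Re (v (n - k0)%nat)) n =
      sum_f_R0 (fun k0 => Im (u k0 * v (n - k0)%nat)%C) n).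
    rewrite <- plus_sum. reflexivity.
Qed.

Lemma taylor_abs_at (f : C -> C) (a : nat -> C) (z : C) :
  taylor_on_disk f a -> in_disk z -> ex_series (fun n => Cmod (a n * z ^ n)%C).
Proof.
  intros H Hz. eapply ex_series_ext;
    [|apply (taylor_abs f a (Cmod z) H); split; [apply Cmod_ge_0 | exact Hz]].
  intros n; cbv beta. now rewrite Cmod_mult, Cmod_pow.
Qed.

Lemma taylor_mult (f g : C -> C) (a b : nat -> C) :
  taylor_on_disk f a -> taylor_on_disk g b ->
  taylor_on_disk (fun z => f z * g z)%C (conv a b).
Proof.
  intros Hf Hg. apply taylor_csum. intros z Hz.
  eapply csum_ext; [|apply csum_mult;
    [ apply (proj1 (taylor_csum f a) Hf z Hz) | apply (proj1 (taylor_csum g b) Hg z Hz)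
    | exact (taylor_abs_at f a z Hf Hz) | exact (taylor_abs_at g b z Hg Hz)]].
  intros n. unfold conv.
  rewrite <- (sum_n_mult_r (K := C_Ring) (z ^ n)%C).
  apply (sum_n_ext_loc (G := C_AbelianMonoid)). intros k Hk.
  change (a k * z ^ k * (b (n - k)%nat * z ^ (n - k)) = a k * b (n - k)%nat * z ^ n)%C.
  replace n with (k + (n - k))%nat at 4 by lia.
  rewrite Cpow_add_r. ring.
Qed.

Lemma taylor_plus (f g : C -> C) (a b : nat -> C) :
  taylor_on_disk f a -> taylor_on_disk g b ->
  taylor_on_disk (fun z => f z + g z)%C (fun n => a n + b n)%C.
Proof.
  rewrite !taylor_csum. intros Hf Hg z Hz.
  eapply csum_ext; [|apply csum_plus; [apply Hf, Hz | apply Hg, Hz]].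
  intros n; cbv beta; ring.
Qed.

Lemma taylor_scal (k : C) (f : C -> C) (a : nat -> C) :
  taylor_on_disk f a -> taylor_on_disk (fun z => k * f z)%C (fun n => k * a n)%C.
Proof.
  rewrite !taylor_csum. intros Hf z Hz.
  eapply csum_ext; [|apply csum_scal, Hf, Hz].
  intros n; cbv beta; ring.
Qed.

Lemma taylor_minus (f g : C -> C) (a b : nat -> C) :
  taylor_on_disk f a -> taylor_on_disk g b ->
  taylor_on_disk (fun z => f z - g z)%C (fun n => a n - b n)%C.
Proof.
  intros Hf Hg. pose proof (taylor_plus _ _ _ _ Hf (taylor_scal (-(1)) _ _ Hg)) as H.
  refine (taylor_ext _ _ _ _ _ _ H); intros; cbv beta; ring.
Qed.

Definition incr (a : nat -> C) (n : nat) : C :=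
  match n with O => 0%C | S m => a m end.

Lemma taylor_incr (f : C -> C) (a : nat -> C) :
  taylor_on_disk f a -> taylor_on_disk (fun z => z * f z)%C (incr a).
Proof.
  rewrite !taylor_csum. intros Hf z Hz. apply csum_shift.
  replace (z * f z - incr a 0 * z ^ 0)%C with (z * f z)%C by (simpl; ring).
  eapply csum_ext; [|apply csum_scal, Hf, Hz].
  intros n; simpl; ring.
Qed.

Lemma csum_0 : csum (fun _ => 0%C) 0%C.
Proof.
  apply csum_eps. intros eps He. exists 0%nat. intros n _.
  replace (Csum (fun _ => RtoC 0) n) with (RtoC 0).
  - replace (0 - 0)%C with (RtoC 0) by ring. now rewrite Cmod_0.
  - induction n as [|n IH]; [now rewrite Csum_0|].
    rewrite Csum_S, <- IH. ring.
Qed.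

Lemma taylor_one : taylor_on_disk (fun _ => 1%C) (fun n => match n with O => 1%C | _ => 0%C end).
Proof.
  apply taylor_csum. intros z _. apply csum_shift.
  replace (1 - 1 * z ^ 0)%C with (RtoC 0) by (simpl; ring).
  eapply csum_ext; [|apply csum_0]. intros n; simpl; ring.
Qed.

Lemma taylor_at_0 (f : C -> C) (a : nat -> C) : taylor_on_disk f a -> f 0%C = a 0%nat.
Proof.
  rewrite taylor_csum. intros H.
  assert (H0 : in_disk 0) by (unfold in_disk; rewrite Cmod_0; lra).
  specialize (H _ H0). apply csum_shift in H.
  assert (E : (f 0 - a 0%nat * 0 ^ 0)%C = 0%C).
  { eapply csum_unique; [exact H|]. eapply csum_ext; [|apply csum_0].
    intros n; simpl; ring. }
  apply Ceq_minus. etransitivity; [|exact E]. simpl; ring.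
Qed.

(** Removes one factor [z]. The quotient [(f z - a 0) / z] is completed at 0 by [a 1], the value
    there of the shifted series. *)
Lemma taylor_split (f : C -> C) (a : nat -> C) :
  taylor_on_disk f a ->
  exists g, taylor_on_disk g (fun n => a (S n)) /\
    forall z, in_disk z -> f z = (a 0%nat + z * g z)%C.
Proof.
  intros H.
  exists (fun z => if Req_EM_T (Cmod z) 0 then a 1%nat else ((f z - a 0%nat) / z)%C).
  split.
  - apply taylor_csum. intros z Hz. destruct (Req_EM_T (Cmod z) 0) as [E|E].
    + apply Cmod_eq_0 in E. subst z. apply csum_shift.
      replace (a 1%nat - a 1%nat * 0 ^ 0)%C with (RtoC 0) by (simpl; ring).
      eapply csum_ext; [|apply csum_0]. intros n; simpl; ring.
    + assert (Hz0 : z <> 0%C) by (intros K; subst z; apply E, Cmod_0).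
      pose proof (proj1 (csum_shift _ _) (proj1 (taylor_csum f a) H z Hz)) as K.
      apply (csum_scal (/ z)) in K.
      eapply csum_ext; [|replace ((f z - a 0%nat) / z)%C
        with (/ z * (f z - a 0%nat * z ^ 0))%C by (simpl; field; auto); exact K].
      intros n; cbv beta. simpl. field; auto.
  - intros z Hz. destruct (Req_EM_T (Cmod z) 0) as [E|E].
    + apply Cmod_eq_0 in E. subst z. rewrite (taylor_at_0 f a H). ring.
    + assert (Hz0 : z <> 0%C) by (intros K; subst z; apply E, Cmod_0).
      field; auto.
Qed.

Lemma taylor_bounded (f : C -> C) (a : nat -> C) (r : R) :
  taylor_on_disk f a -> 0 <= r < 1 ->
  exists M, 0 <= M /\ forall z, Cmod z <= r -> Cmod (f z) <= M.
Proof.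
  intros H Hr. destruct (taylor_abs f a r H Hr) as [M HM].
  assert (HB : forall z, Cmod z <= r -> Cmod (f z) <= M).
  { intros z Hz.
    refine (csum_Cmod_le _ _ _ _ _ (proj1 (taylor_csum f a) H z _) HM);
      [|unfold in_disk; lra].
    intros n. rewrite Cmod_mult, Cmod_pow. apply Rmult_le_compat_l; [apply Cmod_ge_0|].
    apply pow_incr. split; [apply Cmod_ge_0 | exact Hz]. }
  exists M. split; [|exact HB].
  eapply Rle_trans; [apply (Cmod_ge_0 (f 0%C))|]. apply HB. rewrite Cmod_0; lra.
Qed.

(** Letting [z] tend to 0 in [h z = a 0 + z * g z] forces [a 0 = 0]; dividing the bound by [|z|]
    then leaves the same situation for [g] with exponent [m - 1]. This reads off coefficients from a
    local estimate alone. *)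
Lemma taylor_vanish (m : nat) : forall (h : C -> C) (a : nat -> C) (delta M : R),
  taylor_on_disk h a -> 0 < delta ->
  (forall z : C, z <> 0%C -> Cmod z < delta -> Cmod (h z) <= M * Cmod z ^ m) ->
  forall k, (k < m)%nat -> a k = 0%C.
Proof.
  induction m as [|m IH]; intros h a delta M H Hd Hb k Hk; [lia|].
  destruct (taylor_split h a H) as [g [Hg Heq]].
  destruct (taylor_bounded g _ (1/2) Hg) as [K [HK HgK]]; [lra|].
  assert (HM : 0 <= Rabs M) by apply Rabs_pos.
  assert (E0 : a 0%nat = 0%C).
  { apply Cmod_eq_0, Rle_antisym; [|apply Cmod_ge_0].
    apply le_epsilon. intros eps He. rewrite Rplus_0_l.
    (* A real test point: inside the range of the hypothesis, inside the disk where [K] bounds [g],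
       and so small that [|a 0| <= |M| t + K t <= eps]. *)
    set (t := Rmin (Rmin (delta / 2) (1 / 2)) (eps / (K + Rabs M + 1))).
    assert (Ht : 0 < t) by (repeat apply Rmin_pos; try apply Rdiv_lt_0_compat; lra).
    assert (Ht1 : t <= delta / 2) by (eapply Rle_trans; apply Rmin_l).
    assert (Ht2 : t <= 1 / 2)
      by (eapply Rle_trans; [apply Rmin_l | apply Rmin_r]).
    assert (Ht3 : t * (K + Rabs M + 1) <= eps).
    { apply (Rmult_le_reg_r (/ (K + Rabs M + 1))); [apply Rinv_0_lt_compat; lra|].
      rewrite Rmult_assoc, Rinv_r, Rmult_1_r by lra. apply Rmin_r. }
    assert (Hmt : Cmod t = t) by (rewrite Cmod_R; apply Rabs_pos_eq; lra).
    assert (Hnz : RtoC t <> 0%C) by (intros F; apply RtoC_inj in F; lra).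
    pose proof (Hb t Hnz ltac:(lra)) as H1. rewrite Hmt in H1.
    pose proof (HgK t ltac:(lra)) as H2.
    rewrite (Heq t) in H1 by (unfold in_disk; lra).
    replace (a 0%nat) with ((a 0%nat + t * g t) + - (t * g t))%C by ring.
    eapply Rle_trans; [apply Cmod_triangle|].
    rewrite Cmod_opp, Cmod_mult, Hmt.
    assert (H3 : M * t ^ S m <= Rabs M * t).
    { simpl. pose proof (Rle_abs M).
      assert (t ^ m <= 1 ^ m) by (apply pow_incr; lra). rewrite pow1 in *.
      assert (0 <= t ^ m) by (apply pow_le; lra).
      apply Rle_trans with (Rabs M * (t * t ^ m)).
      - apply Rmult_le_compat_r; [apply Rmult_le_pos; lra | assumption].
      - apply Rmult_le_compat_l; [assumption | nra]. }
    nra. }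
  destruct k as [|k]; [exact E0|].
  refine (IH g (fun n => a (S n)) (Rmin delta (1/2)) M Hg _ _ k _).
  - apply Rmin_pos; lra.
  - intros z Hz Hzd.
    pose proof (Rmin_l delta (1/2)) as L1. pose proof (Rmin_r delta (1/2)) as L2.
    pose proof (Hb z Hz ltac:(lra)) as H1.
    rewrite (Heq z), E0, Cplus_0_l, Cmod_mult in H1 by (unfold in_disk; lra).
    apply (Rmult_le_reg_l (Cmod z)); [now apply Cmod_gt_0|]. simpl in H1. lra.
  - lia.
Qed.

(** * Integration along segments and the exponential *)

Lemma is_cderiv_eps (f : C -> C) (z d : C) :
  is_cderiv f z d ->
  forall eps, 0 < eps -> exists delta, 0 < delta /\
    forall h, Cmod h < delta -> Cmod (f (z + h) - f z - h * d)%C <= eps * Cmod h.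
Proof.
  intros [_ H] eps He.
  specialize (H z (fun P HP => HP) (mkposreal eps He)).
  apply (locally_norm_le_locally (V := AbsRing_NormedModule C_AbsRing)) in H.
  destruct H as [delta H].
  exists delta. split; [apply cond_pos|]. intros h Hh.
  specialize (H (z + h)%C).
  assert (E : (z + h - z)%C = h) by ring.
  change (Cmod (z + h - z)%C < delta -> Cmod (f (z + h) - f z - (z + h - z) * d)%C
    <= eps * Cmod (z + h - z)%C) in H.
  rewrite E in H. exact (H Hh).
Qed.

Lemma norm_C_R (z : C) : @norm R_AbsRing C_R_NormedModule z = Cmod z.
Proof.
  unfold Cmod. destruct z as [x y].
  change (sqrt (Rabs x ^ 2 + Rabs y ^ 2) = sqrt (x ^ 2 + y ^ 2)).
  now rewrite !pow2_abs.
Qed.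

(** Chain rule for a complex derivative along the real parameter of a segment; it passes from [C] as
    a module over itself to [C] as a real module, where [RInt] lives. *)
Lemma is_derive_segment (f : C -> C) (z d : C) (s : R) :
  is_cderiv f (s * z)%C d ->
  @is_derive R_AbsRing C_R_NormedModule (fun t : R => f (t * z)%C) s (d * z)%C.
Proof.
  intros H. split.
  - apply (is_linear_scal_l (V := C_R_NormedModule)).
  - intros x Hx.
    apply (is_filter_lim_locally_unique (V := AbsRing_NormedModule R_AbsRing)) in Hx.
    subst x. intros eps.
    pose proof (Cmod_ge_0 z) as Hz.
    (* The increment of the argument has modulus [|t - s| |z|]; dividing by [Cmod z + 1] covers
       [z = 0] as well. *)
    destruct (is_cderiv_eps f _ d H (eps / (Cmod z + 1))) as [delta [Hd HD]].
    { apply Rdiv_lt_0_compat; [apply cond_pos | lra]. }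
    assert (Hp : 0 < delta / (Cmod z + 1)) by (apply Rdiv_lt_0_compat; lra).
    exists (mkposreal _ Hp). intros t Ht.
    change (Rabs (t - s) < delta / (Cmod z + 1)) in Ht.
    match goal with |- @norm _ _ ?u <= _ =>
      change (@norm R_AbsRing C_R_NormedModule (u : C) <= eps * Rabs (t - s)) end.
    rewrite norm_C_R.
    assert (Hm : Cmod ((t - s)%R * z)%C = Rabs (t - s) * Cmod z)
      by (rewrite Cmod_mult, Cmod_R; reflexivity).
    pose proof (Rabs_pos (t - s)) as Hts.
    assert (Hsmall : Cmod ((t - s)%R * z)%C < delta).
    { rewrite Hm. apply (Rmult_lt_compat_r (Cmod z + 1)) in Ht; [|lra].
      unfold Rdiv in Ht. rewrite Rmult_assoc, Rinv_l, Rmult_1_r in Ht by lra. nra. }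
    specialize (HD _ Hsmall). rewrite Hm in HD.
    match goal with |- Cmod ?u <= _ =>
      replace (u : C) with (f (s * z + (t - s)%R * z) - f (s * z) - (t - s)%R * z * d)%C end.
    + eapply Rle_trans; [apply HD|].
      pose proof (cond_pos eps).
      assert (eps / (Cmod z + 1) * (Cmod z + 1) = eps) by (field; lra).
      assert (0 < eps / (Cmod z + 1)) by (apply Rdiv_lt_0_compat; lra). nra.
    + replace (s * z + (t - s)%R * z)%C with (t * z)%C by (rewrite RtoC_minus; ring).
      change (f (t * z) - f (s * z) - (t - s)%R * z * d =
        f (t * z) - f (s * z) - @scal R_AbsRing C_R_NormedModule (t - s)%R (d * z))%C.
      rewrite scal_R_Cmult. ring.
Qed.

(* Coquelicot puts two distinct uniform structures on [C]; derivatives agree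
   because they only depend on the norm. *)
Lemma is_cderiv_AbsRing (f : C -> C) (z d : C) :
  is_cderiv f z d <->
  @is_derive C_AbsRing (AbsRing_NormedModule C_AbsRing) f z d.
Proof.
  split; intros [_ H]; split.
  - apply (is_linear_scal_l (V := AbsRing_NormedModule C_AbsRing)).
  - exact H.
  - apply (is_linear_scal_l (V := C_NormedModule)).
  - exact H.
Qed.

Lemma is_cderiv_const (k z : C) : is_cderiv (fun _ => k) z 0%C.
Proof. exact (is_derive_const (V := C_NormedModule) k z). Qed.

Lemma is_cderiv_id (z : C) : is_cderiv (fun w => w) z 1%C.
Proof. apply is_cderiv_AbsRing. exact (is_derive_id (K := C_AbsRing) z). Qed.

Lemma is_cderiv_mult (f g : C -> C) (z k l : C) :
  is_cderiv f z k -> is_cderiv g z l ->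
  is_cderiv (fun w => f w * g w)%C z (k * g z + f z * l)%C.
Proof.
  rewrite !is_cderiv_AbsRing. intros Hf Hg.
  exact (is_derive_mult (K := C_AbsRing) f g z k l Hf Hg Cmult_comm).
Qed.

Lemma is_cderiv_comp (f g : C -> C) (z k l : C) :
  is_cderiv f (g z) k -> is_cderiv g z l -> is_cderiv (fun w => f (g w)) z (l * k)%C.
Proof.
  rewrite (is_cderiv_AbsRing g).
  exact (is_derive_comp (V := C_NormedModule) f g z k l).
Qed.

(** Fundamental theorem of calculus on [[0, z]]; the differentiability of [g] supplies the
    continuity of the integrand. *)
Lemma is_RInt_segment (f g : C -> C) (z : C) :
  (forall s : R, 0 <= s <= 1 -> is_cderiv f (s * z)%C (g (s * z)%C)) ->
  (forall s : R, 0 <= s <= 1 -> exists d, is_cderiv g (s * z)%C d) ->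
  @is_RInt C_R_NormedModule (fun s : R => g (s * z) * z)%C 0 1 (f z - f 0)%C.
Proof.
  intros Hf Hg.
  replace (f z - f 0)%C with
    (@minus C_R_NormedModule (f (1%R * z)%C) (f (0%R * z)%C)).
  2:{ rewrite Cmult_1_l, Cmult_0_l. reflexivity. }
  apply (is_RInt_derive (V := C_R_CompleteNormedModule) (fun s : R => f (s * z)%C)
           (fun s : R => g (s * z) * z)%C);
    rewrite Rmin_left, Rmax_right by lra; intros s Hs.
  - apply is_derive_segment, Hf, Hs.
  - destruct (Hg s Hs) as [d Hd].
    apply (ex_derive_continuous (V := C_R_NormedModule)).
    exists (d * z * z)%C.
    apply (is_derive_segment (fun w => g w * z)%C z (d * z)%C s).
    replace (d * z)%C with (d * z + g (s * z) * 0)%C by ring.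
    apply (is_cderiv_mult g (fun _ => z)); [exact Hd | apply is_cderiv_const].
Qed.

Lemma in_disk_segment (s : R) (z : C) : 0 <= s <= 1 -> in_disk z -> in_disk (s * z)%C.
Proof.
  unfold in_disk. intros Hs Hz. rewrite Cmod_mult, Cmod_R, Rabs_pos_eq by lra.
  pose proof (Cmod_ge_0 z). nra.
Qed.

(** [f z - f 0] is the integral of 0 along the segment, which stays in the disk. *)
Lemma is_cderiv_0_const (f : C -> C) (z : C) :
  (forall w, in_disk w -> is_cderiv f w 0%C) -> in_disk z -> f z = f 0%C.
Proof.
  intros Hf Hz.
  assert (H : @is_RInt C_R_NormedModule (fun s : R => 0 * z)%C 0 1 (f z - f 0)%C).
  { apply (is_RInt_segment f (fun _ => 0%C) z).
    - intros s Hs. apply Hf, in_disk_segment; assumption.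
    - intros s Hs. exists 0%C. apply is_cderiv_const. }
  apply (is_RInt_unique (V := C_R_CompleteNormedModule)) in H.
  pose proof (RInt_const (V := C_R_CompleteNormedModule) 0 1 (0 * z)%C) as K.
  apply Ceq_minus. rewrite <- H. etransitivity; [exact K|].
  etransitivity; [apply scal_R_Cmult|]. ring.
Qed.

(** * The complex exponential and its differential equation *)

Lemma cexp_0 : cexp 0%C = 1%C.
Proof. unfold cexp. simpl. now rewrite exp_0, cos_0, sin_0, !Rmult_1_l. Qed.

Lemma cexp_plus (z w : C) : cexp (z + w)%C = (cexp z * cexp w)%C.
Proof.
  destruct z as [x y], w as [u v]. unfold cexp, Cplus, Cmult; simpl.
  rewrite exp_plus, cos_plus, sin_plus. f_equal; ring.
Qed.

Lemma cexp_opp (z : C) : (cexp z * cexp (- z))%C = 1%C.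
Proof. rewrite <- cexp_plus, <- cexp_0. f_equal. ring. Qed.

Lemma cexp_nz (z : C) : cexp z <> 0%C.
Proof.
  intros H. pose proof (cexp_opp z) as K. rewrite H, Cmult_0_l in K.
  apply C1_nz. now symmetry.
Qed.

(** From [1 + x <= exp x] and [1 - x <= exp (- x)] one gets [1 + x <= exp x <= 1 / (1 - x)], and [1
    / (1 - x) - 1 - x = x^2 / (1 - x) <= 2 x^2] when [|x| <= 1/2]. *)
Lemma exp_quadratic (x : R) : Rabs x <= 1 / 2 -> Rabs (exp x - 1 - x) <= 2 * x ^ 2.
Proof.
  intros Hx. apply Rabs_le_between in Hx.
  pose proof (exp_ineq1_le x) as H1. pose proof (exp_ineq1_le (- x)) as H2.
  pose proof (exp_pos x) as H3.
  assert (H4 : exp x * exp (- x) = 1) by (rewrite <- exp_plus, Rplus_opp_r; apply exp_0).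
  rewrite Rabs_pos_eq by lra.
  assert (exp x * (1 - x) <= 1) by nra. nra.
Qed.

Lemma Rabs_sin_le (y : R) : Rabs (sin y) <= Rabs y.
Proof.
  destruct (MVT_gen sin 0 y cos) as [c [_ Hc]].
  - intros x _. auto_derive; [exact I | ring].
  - intros x _. apply continuity_sin.
  - rewrite sin_0, !Rminus_0_r in Hc. rewrite Hc, Rabs_mult.
    pose proof (Rabs_pos y). assert (Rabs (cos c) <= 1) by (apply Rabs_le, COS_bound). nra.
Qed.

Lemma cos_quadratic (y : R) : Rabs (cos y - 1) <= y ^ 2 / 2.
Proof.
  replace y with (2 * (y / 2)) at 1 by field. rewrite cos_2a_sin.
  replace (1 - 2 * sin (y / 2) * sin (y / 2) - 1) with (- (2 * sin (y/2) ^ 2)) by ring.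
  rewrite Rabs_Ropp, Rabs_pos_eq by (pose proof (pow2_ge_0 (sin (y/2))); lra).
  pose proof (Rabs_sin_le (y / 2)) as H. apply pow_maj_Rabs with (n := 2%nat) in H.
  rewrite pow2_abs in H. lra.
Qed.

Lemma sin_quadratic (y : R) : Rabs y <= 1 -> Rabs (sin y - y) <= y ^ 2.
Proof.
  intros Hy.
  destruct (MVT_gen (fun t => sin t - t) 0 y (fun t => cos t - 1)) as [c [Hc E]].
  - intros x _. auto_derive; [exact I | ring].
  - intros x _. apply derivable_continuous_pt.
    apply derivable_pt_minus; [apply derivable_pt_sin | apply derivable_pt_id].
  - rewrite sin_0, !Rminus_0_r in E. rewrite E, Rabs_mult.
    assert (Hcy : Rabs c <= Rabs y).
    { revert Hc. unfold Rmin, Rmax, Rabs.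
      destruct (Rle_dec 0 y); destruct (Rcase_abs c); destruct (Rcase_abs y); lra. }
    pose proof (cos_quadratic c) as H. rewrite <- (pow2_abs c) in H.
    rewrite <- (pow2_abs y).
    pose proof (Rabs_pos c). pose proof (Rabs_pos y). pose proof (Rabs_pos (cos c - 1)).
    assert (Rabs (cos c - 1) <= Rabs y) by nra. nra.
Qed.

Lemma cexp_quadratic (h : C) :
  Cmod h <= 1 / 2 -> Cmod (cexp h - 1 - h)%C <= 10 * Cmod h ^ 2.
Proof.
  intros H.
  pose proof (re_le_Cmod h) as Hx. pose proof (im_le_Cmod h) as Hy.
  rewrite Cmod2_alt. eapply Rle_trans; [apply Cmod_le_abs|].
  destruct h as [x y]. unfold Re, Im in *; simpl fst in *; simpl snd in *.
  pose proof (exp_quadratic x ltac:(lra)) as He.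
  pose proof (cos_quadratic y) as Hc. pose proof (sin_quadratic y ltac:(lra)) as Hs.
  pose proof (Rabs_sin_le y) as Hs1.
  assert (Hc1 : Rabs (cos y) <= 1) by (apply Rabs_le, COS_bound).
  (* Each component is split into pieces of second order. Their bounds add up to
     [4 x^2 + 2 y^2 + |x y|], comfortably below [10 (x^2 + y^2)]. *)
  replace (exp x * cos y + - (1) + - x) with
    ((exp x - 1 - x) * cos y + (1 + x) * (cos y - 1)) by ring.
  replace (exp x * sin y + - 0 + - y) with
    ((exp x - 1 - x) * sin y + x * sin y + (sin y - y)) by ring.
  pose proof (Rabs_triang ((exp x - 1 - x) * cos y) ((1 + x) * (cos y - 1))) as T1.
  pose proof (Rabs_triang ((exp x - 1 - x) * sin y + x * sin y) (sin y - y)) as T2.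
  pose proof (Rabs_triang ((exp x - 1 - x) * sin y) (x * sin y)) as T3.
  rewrite !Rabs_mult in T1, T3.
  pose proof (Rabs_pos (exp x - 1 - x)). pose proof (Rabs_pos (cos y - 1)).
  pose proof (Rabs_pos x). pose proof (Rabs_pos y). pose proof (Rabs_pos (sin y)).
  assert (Rabs (1 + x) <= 2).
  { apply Rabs_le_between in Hx. apply Rabs_le. lra. }
  rewrite <- (pow2_abs x) in *. rewrite <- (pow2_abs y) in *.
  assert (Rabs (exp x - 1 - x) * Rabs (cos y) <= 2 * Rabs x ^ 2 * 1)
    by (apply Rmult_le_compat; auto using Rabs_pos).
  assert (Rabs (1 + x) * Rabs (cos y - 1) <= 2 * (Rabs y ^ 2 / 2))
    by (apply Rmult_le_compat; auto using Rabs_pos).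
  assert (Rabs (exp x - 1 - x) * Rabs (sin y) <= 2 * Rabs x ^ 2 * 1)
    by (apply Rmult_le_compat; auto using Rabs_pos; lra).
  assert (Rabs x * Rabs (sin y) <= Rabs x * Rabs y)
    by (apply Rmult_le_compat_l; auto).
  pose proof (pow2_ge_0 (Rabs x - Rabs y)).
  nra.
Qed.

Lemma is_cderiv_cexp (z : C) : is_cderiv cexp z (cexp z).
Proof.
  apply (is_cderiv_quadratic cexp z (cexp z) (1/2) (Cmod (cexp z) * 10)); [lra|].
  intros h Hh. rewrite cexp_plus.
  replace (cexp z * cexp h - cexp z - h * cexp z)%C
    with (cexp z * (cexp h - 1 - h))%C by ring.
  rewrite Cmod_mult, Rmult_assoc. apply Rmult_le_compat_l; [apply Cmod_ge_0|].
  apply cexp_quadratic. lra.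
Qed.

Lemma is_cderiv_opp (f : C -> C) (z k : C) :
  is_cderiv f z k -> is_cderiv (fun w => - f w)%C z (- k)%C.
Proof. exact (is_derive_opp (V := C_NormedModule) f z k). Qed.

(** The product [E exp (- G)] has derivative zero, hence is constant on the disk and equal to its
    value 1 at 0. *)
Lemma log_derivative_exp (E G g : C -> C) :
  (forall z, in_disk z -> is_cderiv E z (g z * E z)%C) ->
  (forall z, in_disk z -> is_cderiv G z (g z)) ->
  E 0%C = cexp (G 0%C) ->
  forall z, in_disk z -> E z = cexp (G z).
Proof.
  intros HE HG H0 z Hz.
  assert (K : (E z * cexp (- G z) = E 0 * cexp (- G 0))%C).
  { apply (is_cderiv_0_const (fun z => E z * cexp (- G z))%C z); [|exact Hz].
    intros w Hw.
    replace (RtoC 0) with (g w * E w * cexp (- G w) + E w * (- g w * cexp (- G w)))%C by ring.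
    apply (is_cderiv_mult E (fun w => cexp (- G w))); [now apply HE|].
    apply (is_cderiv_comp cexp (fun w => - G w)%C w (cexp (- G w)) (- g w)%C); [apply is_cderiv_cexp|].
    apply (is_cderiv_opp G). now apply HG. }
  rewrite H0, cexp_opp in K.
  replace (E z) with (cexp (G z) * (E z * cexp (- G z)))%C.
  - rewrite K. ring.
  - transitivity (E z * (cexp (G z) * cexp (- G z)))%C; [ring|].
    rewrite cexp_opp. ring.
Qed.

(** * Coefficients of a function subordinate to [phi0] *)

Lemma taylor_fun_unique (f g : C -> C) (a : nat -> C) (z : C) :
  taylor_on_disk f a -> taylor_on_disk g a -> in_disk z -> f z = g z.
Proof.
  rewrite !taylor_csum. intros Hf Hg Hz.
  exact (csum_unique _ _ _ (Hf z Hz) (Hg z Hz)).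
Qed.

(** The geometric series dominates. The sum is defined through the real and imaginary parts because
    [Series] is a total function on real sequences. *)
Lemma taylor_exists (a : nat -> C) :
  (forall n, Cmod (a n) <= 1) -> exists f, taylor_on_disk f a.
Proof.
  intros H.
  exists (fun z => (Series (fun n => Re (a n * z ^ n)%C),
                    Series (fun n => Im (a n * z ^ n)%C))).
  apply taylor_csum. intros z Hz.
  destruct (ex_csum_abs (fun n => a n * z ^ n)%C (fun n => Cmod z ^ n)) as [l Hl].
  - intros n. rewrite Cmod_mult, Cmod_pow.
    pose proof (pow_le (Cmod z) n (Cmod_ge_0 z)). pose proof (H n). nra.
  - apply ex_series_geom. rewrite Rabs_pos_eq by apply Cmod_ge_0. exact Hz.
  - pose proof (proj1 (csum_Re_Im _ _) Hl) as [H1 H2].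
    rewrite (is_series_unique _ _ H1), (is_series_unique _ _ H2).
    replace (Re l, Im l) with l by (destruct l; reflexivity). exact Hl.
Qed.

Definition exp_coef (n : nat) : C := RtoC (/ INR (fact n)).

Lemma exp_coef_le_1 (n : nat) : 0 < / INR (fact n) <= 1.
Proof.
  assert (1 <= INR (fact n)) by (apply (le_INR 1), lt_O_fact).
  split; [apply Rinv_0_lt_compat; lra|].
  rewrite <- Rinv_1. apply Rinv_le_contravar; lra.
Qed.

(** The sum [S] of the exponential series satisfies [S' = S] and [S 0 = 1], so it is [exp] by the
    differential equation with [G z = z], [g = 1]. *)
Lemma taylor_cexp : taylor_on_disk cexp exp_coef.
Proof.
  destruct (taylor_exists exp_coef) as [S HS].
  { intros n. unfold exp_coef. rewrite Cmod_R.
    pose proof (exp_coef_le_1 n). rewrite Rabs_pos_eq; lra. }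
  destruct (taylor_derive S exp_coef HS) as [HT HD].
  assert (HSS : taylor_on_disk (C_derive S) exp_coef).
  { refine (taylor_ext _ _ _ _ _ _ HT); [reflexivity|].
    intros n. unfold exp_coef. rewrite <- RtoC_mult. f_equal.
    rewrite fact_simpl, mult_INR.
    field. split; [apply INR_fact_neq_0 | apply not_0_INR; lia]. }
  refine (taylor_ext S cexp exp_coef exp_coef _ (fun n => eq_refl) HS).
  apply (log_derivative_exp S (fun z => z) (fun _ => 1%C)).
  - intros z Hz. rewrite Cmult_1_l, <- (taylor_fun_unique _ _ _ z HSS HS Hz).
    exact (HD z Hz).
  - intros z _. apply is_cderiv_id.
  - rewrite (taylor_at_0 _ _ HS), cexp_0. unfold exp_coef; simpl. now rewrite Rinv_1.
Qed.

(** The factor [(1 + (-1)^n) / 2] selects the even indices of the exponential series, giving [cosh];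
    index 1 is set apart because it comes from the summand [z]. *)
Definition phi0_coef (n : nat) : C :=
  match n with
  | 1%nat => 1%C
  | _ => RtoC ((1 + (-1) ^ n) / 2 * / INR (fact n))
  end.

Lemma phi0_coef_le_1 (n : nat) : Cmod (phi0_coef n) <= 1.
Proof.
  assert (H : Cmod (RtoC ((1 + (-1) ^ n) / 2 * / INR (fact n))) <= 1).
  { rewrite Cmod_R, Rabs_mult. pose proof (exp_coef_le_1 n) as H.
    rewrite (Rabs_pos_eq (/ _)) by lra.
    assert (Rabs ((1 + (-1) ^ n) / 2) <= 1).
    { assert (-1 <= (-1) ^ n <= 1) by (apply Rabs_le_between; now rewrite pow_1_abs; lra).
      apply Rabs_le. lra. }
    pose proof (Rabs_pos ((1 + (-1) ^ n) / 2)). nra. }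
  destruct n as [|[|n]]; [exact H | simpl; rewrite Cmod_1; lra | exact H].
Qed.

Lemma taylor_phi0 : taylor_on_disk phi0 phi0_coef.
Proof.
  assert (HN : taylor_on_disk (fun z => cexp (- z)) (fun n => RtoC ((-1) ^ n) * exp_coef n)%C).
  { apply taylor_csum. intros z Hz.
    assert (Hz' : in_disk (- z)%C) by (unfold in_disk; now rewrite Cmod_opp).
    eapply csum_ext; [|exact (proj1 (taylor_csum _ _) taylor_cexp _ Hz')].
    intros n; cbv beta. replace (- z)%C with (RtoC (-1) * z)%C
      by (replace (RtoC (-1)) with (- (1))%C by (rewrite <- RtoC_opp; f_equal; ring); ring).
    rewrite Cpow_mult_l, RtoC_pow. ring. }
  pose proof (taylor_plus _ _ _ _ (taylor_incr _ _ taylor_one)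
    (taylor_scal (RtoC (/ 2)) _ _ (taylor_plus _ _ _ _ taylor_cexp HN))) as H.
  refine (taylor_ext _ _ _ _ _ _ H).
  - intros z _. unfold phi0, ccosh. rewrite RtoC_inv by lra. field.
  - intros [|[|n]]; unfold phi0_coef, exp_coef, incr;
      rewrite <- ?RtoC_mult, <- ?RtoC_plus, <- ?RtoC_mult, <- ?RtoC_plus; f_equal.
    + simpl. field.
    + simpl. field.
    + field. apply INR_fact_neq_0.
Qed.

(** Since the cubic coefficient is zero, the quadratic polynomial already has an error of order
    4. *)
Lemma taylor_phi0_split :
  exists g b, taylor_on_disk g b /\ forall z, in_disk z ->
    phi0 z = (1 + z + / 2 * (z * z) + z ^ 4 * g z)%C.
Proof.
  destruct (taylor_split _ _ taylor_phi0) as [g1 [H1 E1]].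
  destruct (taylor_split _ _ H1) as [g2 [H2 E2]].
  destruct (taylor_split _ _ H2) as [g3 [H3 E3]].
  destruct (taylor_split _ _ H3) as [g4 [H4 E4]].
  exists g4. eexists. split; [exact H4|]. intros z Hz.
  rewrite E1, E2, E3, E4 by exact Hz.
  replace (phi0_coef 0) with (RtoC 1) by (simpl; f_equal; field).
  replace (phi0_coef 1) with (RtoC 1) by reflexivity.
  replace (phi0_coef 2) with (/ 2)%C
    by (simpl; rewrite <- RtoC_inv by lra; f_equal; field).
  replace (phi0_coef 3) with (RtoC 0) by (simpl; f_equal; field).
  ring.
Qed.

Lemma taylor_zderive (f : C -> C) (a : nat -> C) :
  taylor_on_disk f a ->
  taylor_on_disk (fun z => z * C_derive f z)%C (fun n => INR n * a n)%C.
Proof.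
  intros H. refine (taylor_ext _ _ _ _ _ _ (taylor_incr _ _ (proj1 (taylor_derive f a H)))).
  - reflexivity.
  - intros [|n]; [simpl; ring | reflexivity].
Qed.

Lemma conv_0 (a b : nat -> C) : conv a b 0 = (a 0%nat * b 0%nat)%C.
Proof. unfold conv. now rewrite Csum_0. Qed.

Lemma conv_1 (a b : nat -> C) :
  conv a b 1 = (a 0%nat * b 1%nat + a 1%nat * b 0%nat)%C.
Proof. unfold conv. now rewrite Csum_S, Csum_0. Qed.

Lemma conv_2 (a b : nat -> C) :
  conv a b 2 = (a 0%nat * b 2%nat + a 1%nat * b 1%nat + a 2%nat * b 0%nat)%C.
Proof. unfold conv. now rewrite !Csum_S, Csum_0. Qed.

Lemma conv_3 (a b : nat -> C) :
  conv a b 3 = (a 0%nat * b 3%nat + a 1%nat * b 2%nat + a 2%nat * b 1%nat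
                + a 3%nat * b 0%nat)%C.
Proof. unfold conv. now rewrite !Csum_S, Csum_0. Qed.

Lemma conv_4 (a b : nat -> C) :
  conv a b 4 = (a 0%nat * b 4%nat + a 1%nat * b 3%nat + a 2%nat * b 2%nat
                + a 3%nat * b 1%nat + a 4%nat * b 0%nat)%C.
Proof. unfold conv. now rewrite !Csum_S, Csum_0. Qed.

(* Compares coefficients up to order 4 in [z f' = f (1 + w + w^2/2) + O(z^5)]. *)
Lemma log_coeff_schwarz (f w : C -> C) (a c : nat -> C) :
  classA f -> taylor_on_disk f a -> schwarz w -> taylor_on_disk w c ->
  (forall z : C, in_disk z -> z <> 0%C ->
      f z <> 0%C /\ exists d : C, is_cderiv f z d /\ (z * d / f z)%C = phi0 (w z)) ->
  log_coeff a 1 = (c 1%nat / 2)%C /\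
  log_coeff a 2 = ((c 2%nat + c 1%nat * c 1%nat / 2) / 4)%C /\
  log_coeff a 3 = ((c 3%nat + c 1%nat * c 2%nat) / 6)%C.
Proof.
  intros [_ [Hf0 Hf1]] Hf [_ [Hw0 Hwd]] Hw Heq.
  assert (D0 : in_disk 0) by (unfold in_disk; rewrite Cmod_0; lra).
  assert (a0 : a 0%nat = 0%C) by (rewrite <- Hf0; symmetry; now apply taylor_at_0).
  assert (c0 : c 0%nat = 0%C) by (rewrite <- Hw0; symmetry; now apply taylor_at_0).
  assert (a1 : a 1%nat = 1%C).
  { pose proof (taylor_at_0 _ _ (proj1 (taylor_derive f a Hf))) as E.
    rewrite (is_C_derive_unique _ _ _ Hf1) in E. rewrite E. simpl. ring. }
  destruct taylor_phi0_split as [g [b [Hg Eg]]].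
  destruct (taylor_split f a Hf) as [f1 [Hf1' Ef1]].
  destruct (taylor_split w c Hw) as [w1 [Hw1 Ew1]].
  destruct (taylor_bounded f1 _ (1/2) Hf1') as [K1 [P1 B1]]; [lra|].
  destruct (taylor_bounded w1 _ (1/2) Hw1) as [K2 [P2 B2]]; [lra|].
  destruct (taylor_bounded g _ (1/2) Hg) as [K3 [P3 B3]]; [lra|].
  (* [HD] is the expansion of [z f' - f (1 + w + w^2 / 2)], which the subordination turns into
     [f w^4 g(w)] near 0. *)
  pose proof (taylor_minus _ _ _ _ (taylor_zderive f a Hf)
    (taylor_mult _ _ _ _ Hf
      (taylor_plus _ _ _ _ (taylor_plus _ _ _ _ taylor_one Hw)
         (taylor_scal (/ 2) _ _ (taylor_mult _ _ _ _ Hw Hw))))) as HD.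
  (* Order 5 comes from [|f| <= K1 |z|], [|w| <= K2 |z|] and [|g (w z)| <= K3]. The second radius
     forces [|w z| <= 1/2], the range in which [K3] is valid. *)
  pose proof (fun B => taylor_vanish 5 _ _ (Rmin (1/2) (/ (2 * (K2 + 1))))
     (K1 * (K2 ^ 4 * K3)) HD B) as V.
  assert (Hdel : 0 < Rmin (1/2) (/ (2 * (K2 + 1))))
    by (apply Rmin_pos; [lra | apply Rinv_0_lt_compat; lra]).
  specialize (V Hdel).
  assert (Hbound : forall z : C, z <> 0%C -> Cmod z < Rmin (1 / 2) (/ (2 * (K2 + 1))) ->
    Cmod (z * C_derive f z - f z * (1 + w z + / 2 * (w z * w z)))%C
    <= K1 * (K2 ^ 4 * K3) * Cmod z ^ 5).
  { intros z Hz Hzd.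
    pose proof (Rlt_le_trans _ _ _ Hzd (Rmin_l _ _)) as L1.
    pose proof (Rlt_le_trans _ _ _ Hzd (Rmin_r _ _)) as L2.
    assert (Hin : in_disk z) by (unfold in_disk; lra).
    pose proof (Cmod_ge_0 z) as Z0.
    destruct (Heq z Hin Hz) as [Hfz [d [Hd E]]].
    rewrite (is_C_derive_unique _ _ _ Hd).
    assert (W : Cmod (w z) <= K2 * Cmod z).
    { rewrite (Ew1 z Hin), c0, Cplus_0_l, Cmod_mult.
      pose proof (B2 z ltac:(lra)). nra. }
    assert (W2 : Cmod (w z) <= 1 / 2).
    { apply (Rmult_lt_compat_r (2 * (K2 + 1))) in L2; [|lra].
      rewrite Rinv_l in L2 by lra. nra. }
    replace (z * d)%C with (f z * phi0 (w z))%C by (rewrite <- E; field; exact Hfz).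
    rewrite (Eg (w z)) by (unfold in_disk; lra).
    replace (f z * (1 + w z + / 2 * (w z * w z) + w z ^ 4 * g (w z))
             - f z * (1 + w z + / 2 * (w z * w z)))%C
      with (f z * (w z ^ 4 * g (w z)))%C by ring.
    rewrite !Cmod_mult, Cmod_pow.
    replace (K1 * (K2 ^ 4 * K3) * Cmod z ^ 5)
      with ((K1 * Cmod z) * ((K2 * Cmod z) ^ 4 * K3)) by ring.
    apply Rmult_le_compat; [apply Cmod_ge_0 | | |].
    - apply Rmult_le_pos; [apply pow_le|]; apply Cmod_ge_0.
    - rewrite (Ef1 z Hin), a0, Cplus_0_l, Cmod_mult.
      pose proof (B1 z ltac:(lra)). nra.
    - apply Rmult_le_compat; [apply pow_le, Cmod_ge_0 | apply Cmod_ge_0 | | apply B3, W2].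
      apply pow_incr. split; [apply Cmod_ge_0 | exact W]. }
  specialize (V Hbound).
  (* The equations of index 2, 3, 4 are triangular: index [k] expresses [(k - 1) a_k] by earlier
     coefficients of [f] and by those of [w]. *)
  pose proof (V 2%nat ltac:(lia)) as V2.
  pose proof (V 3%nat ltac:(lia)) as V3.
  pose proof (V 4%nat ltac:(lia)) as V4.
  clear - a0 c0 a1 V2 V3 V4.
  cbv beta in V2, V3, V4.
  rewrite conv_2 in V2. rewrite conv_3 in V3. rewrite conv_4 in V4.
  cbv beta iota in V2, V3, V4.
  rewrite !conv_0, !conv_1 in V2.
  rewrite !conv_0, !conv_1, !conv_2 in V3.
  rewrite !conv_0, !conv_1, !conv_2, !conv_3 in V4.
  rewrite a0, c0, a1 in V2, V3, V4.
  replace (INR 2) with 2 in V2 by (simpl; ring).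
  replace (INR 3) with 3 in V3 by (simpl; ring).
  replace (INR 4) with 4 in V4 by (simpl; ring).
  assert (A2 : a 2%nat = c 1%nat).
  { apply Ceq_minus. etransitivity; [|exact V2]. field. }
  rewrite A2 in V3, V4.
  assert (A3 : a 3%nat = ((c 1%nat * c 1%nat + c 2%nat + c 1%nat * c 1%nat / 2) / 2)%C).
  { apply (f_equal (Cmult (/ 2))) in V3. rewrite (Cmult_0_r (/ 2)) in V3.
    apply Ceq_minus. etransitivity; [|exact V3]. field. }
  rewrite A3 in V4.
  assert (A4 : a 4%nat = ((a 3%nat * c 1%nat + c 1%nat * (c 2%nat + c 1%nat * c 1%nat / 2)
                        + c 3%nat + c 1%nat * c 2%nat) / 3)%C).
  { apply (f_equal (Cmult (/ 3))) in V4. rewrite (Cmult_0_r (/ 3)) in V4.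
    rewrite A3. apply Ceq_minus. etransitivity; [|exact V4]. field. }
  unfold log_coeff. rewrite A4, A3, A2. repeat split; field.
Qed.

(** * Parseval identity on roots of unity *)

Lemma sum_n_R_S (u : nat -> R) (n : nat) : sum_n u (S n) = sum_n u n + u (S n).
Proof. apply (sum_Sn (G := R_AbelianMonoid)). Qed.

Lemma sum_n_R_le (u v : nat -> R) (n : nat) :
  (forall k, u k <= v k) -> sum_n u n <= sum_n v n.
Proof.
  intros H. induction n as [|n IH]; [rewrite !sum_O; apply H|].
  rewrite !sum_n_R_S. apply Rplus_le_compat; auto.
Qed.

Lemma sum_n_R_plus (u v : nat -> R) (n : nat) :
  sum_n (fun k => u k + v k) n = sum_n u n + sum_n v n.
Proof. apply (sum_n_plus (G := R_AbelianMonoid)). Qed.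

Lemma sum_n_R_incr (u : nat -> R) (m n : nat) :
  (forall k, 0 <= u k) -> (m <= n)%nat -> sum_n u m <= sum_n u n.
Proof.
  intros H L. induction L as [|n L IH]; [lra|].
  rewrite sum_n_R_S. pose proof (H (S n)). lra.
Qed.

Lemma geometric_root_sum (x : C) (m : nat) :
  x <> 1%C -> (x ^ S m)%C = 1%C -> Csum (fun k => x ^ k)%C m = 0%C.
Proof.
  intros Hx Hm.
  assert (E : ((x - 1) * Csum (fun k => x ^ k)%C m = x ^ S m - 1)%C).
  { clear. induction m as [|m IH].
    - rewrite Csum_0. simpl. ring.
    - rewrite Csum_S. rewrite (Cpow_S x (S m)).
      transitivity ((x - 1) * Csum (fun k => x ^ k)%C m
                    + (x - 1) * x ^ S m)%C; [ring|].
      rewrite IH. ring. }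
  rewrite Hm in E.
  assert (Hx1 : (x - 1)%C <> 0%C) by (intros K; apply Hx, Ceq_minus, K).
  replace (Csum (fun k => x ^ k)%C m)
    with (/ (x - 1) * ((x - 1) * Csum (fun k => x ^ k)%C m))%C
    by (field; exact Hx1).
  rewrite E. field. exact Hx1.
Qed.

Definition unit_root (N : nat) : C :=
  (cos (2 * PI / INR N), sin (2 * PI / INR N)).

Lemma unit_root_pow (N k : nat) :
  (unit_root N ^ k)%C = (cos (INR k * (2 * PI / INR N)), sin (INR k * (2 * PI / INR N))).
Proof.
  induction k as [|k IH].
  - simpl. rewrite Rmult_0_l, cos_0, sin_0. reflexivity.
  - rewrite Cpow_S, IH, S_INR, Rmult_plus_distr_r, Rmult_1_l, cos_plus, sin_plus.
    unfold unit_root, Cmult; simpl. f_equal; ring.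
Qed.

Lemma Cmod_unit_root (N : nat) : Cmod (unit_root N) = 1.
Proof.
  unfold Cmod, unit_root; simpl fst; simpl snd. rewrite <- sqrt_1. f_equal.
  rewrite <- !Rsqr_pow2, Rplus_comm. apply sin2_cos2.
Qed.

Lemma unit_root_pow_N (m : nat) : (unit_root (S m) ^ S m)%C = 1%C.
Proof.
  rewrite unit_root_pow.
  replace (INR (S m) * (2 * PI / INR (S m))) with (2 * PI)
    by (field; apply not_0_INR; lia).
  now rewrite cos_2PI, sin_2PI.
Qed.

(** The real part alone decides: [1 - cos (2 t) = 2 sin^2 t] with [t = d PI / N] strictly between 0
    and [PI]. *)
Lemma unit_root_primitive (N d : nat) :
  (0 < d < N)%nat -> (unit_root N ^ d)%C <> 1%C.
Proof.
  intros Hd H. rewrite unit_root_pow in H. apply (f_equal fst) in H. simpl in H.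
  assert (HN : 0 < INR N) by (apply lt_0_INR; lia).
  assert (Hd0 : 0 < INR d) by (apply lt_0_INR; lia).
  assert (HdN : INR d < INR N) by (apply lt_INR; lia).
  pose proof PI_RGT_0 as HPI.
  replace (INR d * (2 * PI / INR N)) with (2 * (INR d * PI / INR N)) in H by (field; lra).
  rewrite cos_2a_sin in H.
  assert (0 < sin (INR d * PI / INR N)).
  { apply sin_gt_0.
    - apply Rdiv_lt_0_compat; [apply Rmult_lt_0_compat|]; lra.
    - apply (Rmult_lt_reg_r (INR N)); [lra|]. unfold Rdiv.
      rewrite Rmult_assoc, Rinv_l by lra. nra. }
  nra.
Qed.

Definition poly_sum (b : nat -> C) (n : nat) (z : C) : C :=
  Csum (fun j => b j * z ^ j)%C n.

Lemma conj_unit_root (N : nat) : (Cconj (unit_root N) * unit_root N)%C = 1%C.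
Proof.
  rewrite Cmult_comm, <- Cmod2_conj, Cmod_unit_root. f_equal; ring.
Qed.

(** Discrete orthogonality of [z^M] to polynomials of lower degree over the [m + 1] roots of unity;
    [M <= m] prevents aliasing. *)
Lemma unit_root_orthogonal (b : nat -> C) (m n M : nat) :
  (n < M)%nat -> (M <= m)%nat ->
  Csum
    (fun k => Cconj ((unit_root (S m) ^ k) ^ M) * poly_sum b n (unit_root (S m) ^ k))%C m
  = 0%C.
Proof.
  set (x := unit_root (S m)). intros Hn HM. induction n as [|n IH].
  (* For a single monomial, [conj x ^ (k j)] cancels [x ^ (k j)]. What remains is a geometric sum of
     ratio [conj x ^ (M - j)], a nontrivial root of unity as [0 < M - j <= m]. *)
  all: assert (T : forall j, (j < M)%nat ->
    Csum (fun k => Cconj ((x ^ k) ^ M) * (b j * (x ^ k) ^ j))%C m = 0%C).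
  1, 3: intros j Hj;
    transitivity (b j * Csum (fun k => (Cconj x ^ (M - j)) ^ k)%C m)%C;
    [ rewrite <- Csum_scal; apply Csum_ext; intros k;
      rewrite <- !Cpow_mult_r, Cpow_conj;
      replace (k * M)%nat with ((M - j) * k + k * j)%nat by nia;
      rewrite Cpow_add_r, !(Nat.mul_comm k j);
      transitivity (b j * Cconj x ^ ((M - j) * k) * (Cconj x * x) ^ (j * k))%C;
      [ rewrite Cpow_mult_l; ring
      | unfold x; rewrite conj_unit_root, Cpow_1_l; ring ]
    | rewrite geometric_root_sum; [ring | |];
      [ rewrite <- Cpow_conj; intros K; apply (f_equal Cconj) in K;
        rewrite Cconj_conj in K; apply (unit_root_primitive (S m) (M - j)); [lia|];
        fold x; rewrite K; unfold Cconj; simpl; now rewrite Ropp_0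
      | rewrite <- Cpow_mult_r, Nat.mul_comm, Cpow_mult_r, <- (Cpow_conj x (S m));
        unfold x; rewrite unit_root_pow_N;
        replace (Cconj 1) with (RtoC 1) by (unfold Cconj; simpl; now rewrite Ropp_0);
        apply Cpow_1_l ] ].
  - etransitivity; [|exact (T 0%nat Hn)]. apply Csum_ext; intros k.
    unfold poly_sum. now rewrite Csum_0.
  - transitivity (0 + 0)%C; [|ring]. rewrite <- (T (S n) Hn) at 2.
    rewrite <- IH at 1 by lia. rewrite <- Csum_plus.
    apply Csum_ext; intros k. unfold poly_sum. rewrite Csum_S. ring.
Qed.

Lemma Cmod2_plus (x y : C) :
  Cmod (x + y)%C ^ 2 = Cmod x ^ 2 + Cmod y ^ 2 + 2 * Re (Cconj y * x)%C.
Proof. rewrite !Cmod2_alt. destruct x, y; unfold Re, Im, Cconj; simpl. ring. Qed.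

(** Pythagoras by induction on the degree: the leading monomial has modulus [|b (S n)|] at every
    sample point and is orthogonal to the rest. *)
Lemma discrete_parseval (b : nat -> C) (m n : nat) :
  (n <= m)%nat ->
  sum_n (fun k => Cmod (poly_sum b n (unit_root (S m) ^ k)%C) ^ 2) m
  = INR (S m) * sum_n (fun j => Cmod (b j) ^ 2) n.
Proof.
  intros Hn. induction n as [|n IH].
  - rewrite sum_O, (Rmult_comm _ (Cmod _ ^ 2)), Rmult_comm, <- sum_n_const.
    apply sum_n_ext; intros k. unfold poly_sum. rewrite Csum_0. simpl. now rewrite Cmult_1_r.
  - rewrite sum_n_R_S, Rmult_plus_distr_l, <- IH by lia.
    rewrite <- sum_n_const, <- sum_n_R_plus.
    set (c := fun k => (Cconj ((unit_root (S m) ^ k) ^ S n)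
                        * poly_sum b n (unit_root (S m) ^ k))%C).
    assert (Z : sum_n (fun k => 2 * Re (Cconj (b (S n)) * c k)%C) m = 0).
    { transitivity (2 * Re (Cconj (b (S n)) * Csum c m)%C).
      - rewrite <- Csum_scal, Re_Csum.
        apply (sum_n_mult_l (K := R_Ring) 2).
      - unfold c. rewrite unit_root_orthogonal by lia. rewrite Cmult_0_r. simpl. ring. }
    symmetry. rewrite <- (Rplus_0_r (sum_n _ m)), <- Z, <- sum_n_R_plus.
    apply sum_n_ext; intros k. symmetry. unfold c, poly_sum.
    rewrite Csum_S, Cmod2_plus.
    rewrite Cmod_mult, !Cmod_pow, Cmod_unit_root, !pow1, Rmult_1_r.
    rewrite Cmult_conj, Cmult_assoc. reflexivity.
Qed.

(** * Bounds for the logarithmic coefficients *)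

(** On [|z| <= r] the tail is dominated by the tail of the real series of [|b_k| r^k], which is
    independent of [z]. This reduces [h] to polynomials, for which the discrete identity is
    exact. *)
Lemma taylor_uniform (h : C -> C) (b : nat -> C) (r eps : R) :
  taylor_on_disk h b -> 0 <= r < 1 -> 0 < eps ->
  exists N, forall n z, (N <= n)%nat -> Cmod z <= r ->
    Cmod (h z - poly_sum b n z)%C <= eps.
Proof.
  intros H Hr He. destruct (taylor_abs h b r H Hr) as [l Hl].
  destruct (proj1 (is_series_R_eps _ _) Hl eps He) as [N HN].
  exists N. intros n z Hn Hz.
  assert (HR : is_series (fun k => Cmod (b (S n + k)%nat) * r ^ (S n + k))
                 (l - sum_n (fun k => Cmod (b k) * r ^ k) n)).
  { apply (is_series_incr_n (V := R_NormedModule) (fun k => Cmod (b k) * r ^ k));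
      [lia|].
    change (is_series (fun k => Cmod (b k) * r ^ k)
      (l - sum_n (fun k => Cmod (b k) * r ^ k) n
       + sum_n (fun k => Cmod (b k) * r ^ k) n)).
    assert (E : forall x y : R, x - y + y = x) by (intros; ring). now rewrite E. }
  assert (HC : csum (fun k => b (S n + k)%nat * z ^ (S n + k))%C (h z - poly_sum b n z)%C).
  { apply (is_series_incr_n (V := C_NormedModule) (fun k => b k * z ^ k)%C); [lia|].
    change (csum (fun k => b k * z ^ k)%C (h z - poly_sum b n z + poly_sum b n z)%C).
    replace (h z - poly_sum b n z + poly_sum b n z)%C with (h z) by ring.
    apply (proj1 (taylor_csum h b) H). unfold in_disk; lra. }
  assert (Cmod (h z - poly_sum b n z)%C <= l - sum_n (fun k => Cmod (b k) * r ^ k) n).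
  { refine (csum_Cmod_le _ _ _ _ _ HC HR). intros k.
    rewrite Cmod_mult, Cmod_pow. apply Rmult_le_compat_l; [apply Cmod_ge_0|].
    apply pow_incr. split; [apply Cmod_ge_0 | exact Hz]. }
  specialize (HN n Hn). apply Rabs_def2 in HN. lra.
Qed.

Lemma bernoulli_sub (r : R) (n : nat) : 0 <= r <= 1 -> 1 - INR n * (1 - r) <= r ^ n.
Proof.
  intros Hr. induction n as [|n IH]; [simpl; lra|].
  rewrite S_INR. simpl pow. pose proof (pos_INR n).
  assert (r * (1 - INR n * (1 - r)) <= r * r ^ n) by (apply Rmult_le_compat_l; lra).
  assert (0 <= INR n * (1 - r) * (1 - r)) by (repeat apply Rmult_le_pos; lra). nra.
Qed.

(* Averages [|h|^2 <= |1 + q z|^2] over the N-th roots of unity on [|z| = r]. *)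
Lemma bessel_circle (h : C -> C) (b : nat -> C) (q : C) (r eps : R) (n : nat) :
  taylor_on_disk h b ->
  (forall z, in_disk z -> Cmod (h z) <= Cmod (1 + q * z)%C) ->
  0 <= r < 1 -> 0 < eps <= 1 ->
  sum_n (fun j => Cmod (b j) ^ 2 * r ^ (2 * j)) n
  <= 1 + Cmod q ^ 2 + eps * (2 * (1 + Cmod q) + 1).
Proof.
  intros H Hq Hr He.
  destruct (taylor_uniform h b r eps H Hr (proj1 He)) as [N0 HN].
  (* Large enough for the uniform approximation, for the [n] terms wanted, and for the degree 1 of
     [1 + q z]. *)
  set (M := (max N0 (max n 1))). set (x := unit_root (S M)).
  (* [beta] and [gam] absorb the radius, so that sampling on [|z| = r] becomes sampling at roots of
     unity. *)
  set (beta := fun j => (b j * RtoC r ^ j)%C).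
  set (gam := fun j => match j with O => RtoC 1 | _ => (q * r)%C end).
  assert (Hx : forall k, Cmod (x ^ k)%C = 1)
    by (intros k; rewrite Cmod_pow; unfold x; rewrite Cmod_unit_root; apply pow1).
  pose proof (Cmod_ge_0 q) as Q0.
  pose proof (discrete_parseval beta M M (le_n M)) as P1.
  pose proof (discrete_parseval gam M 1 ltac:(unfold M; lia)) as P2.
  fold x in P1, P2.
  rewrite (sum_n_R_S _ 0), sum_O in P2. simpl gam in P2. rewrite Cmod_1 in P2.
  (* The error comes from [(A + eps)^2 <= A^2 + eps (2 A + 1)] with [A = |1 + q z| <= 1 + |q|] and
     [eps <= 1]. *)
  assert (Hle : INR (S M) * sum_n (fun j => Cmod (beta j) ^ 2) M <=
    INR (S M) * (1 ^ 2 + Cmod (q * r)%C ^ 2)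
    + INR (S M) * (eps * (2 * (1 + Cmod q) + 1))).
  { rewrite <- P1, <- P2, <- sum_n_const, <- sum_n_R_plus.
    apply sum_n_R_le. intros k.
    set (z := (r * x ^ k)%C).
    assert (Hz : Cmod z = r)
      by (unfold z; rewrite Cmod_mult, Hx, Cmod_R, Rabs_pos_eq; lra).
    assert (E1 : poly_sum beta M (x ^ k)%C = poly_sum b M z).
    { apply Csum_ext. intros j. unfold beta, z. rewrite Cpow_mult_l. ring. }
    assert (E2 : poly_sum gam 1 (x ^ k)%C = (1 + q * z)%C).
    { unfold poly_sum, gam, z. rewrite Csum_S, Csum_0. simpl. ring. }
    rewrite E1, E2.
    pose proof (HN M z ltac:(unfold M; lia) ltac:(lra)) as T.
    pose proof (Hq z ltac:(unfold in_disk; lra)) as T2.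
    assert (T3 : Cmod (1 + q * z)%C <= 1 + Cmod q).
    { eapply Rle_trans; [apply Cmod_triangle|]. rewrite Cmod_1, Cmod_mult, Hz. nra. }
    assert (T4 : Cmod (poly_sum b M z) <= Cmod (1 + q * z)%C + eps).
    { replace (poly_sum b M z) with (h z + - (h z - poly_sum b M z))%C by ring.
      eapply Rle_trans; [apply Cmod_triangle|]. rewrite Cmod_opp. lra. }
    pose proof (Cmod_ge_0 (poly_sum b M z)). pose proof (Cmod_ge_0 (1 + q * z)%C).
    apply Rle_trans with ((Cmod (1 + q * z)%C + eps) ^ 2).
    - apply pow_incr. lra.
    - nra. }
  rewrite <- Rmult_plus_distr_l in Hle.
  apply Rmult_le_reg_l in Hle; [|apply lt_0_INR; lia].
  assert (Eb : forall j, Cmod (beta j) ^ 2 = Cmod (b j) ^ 2 * r ^ (2 * j)).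
  { intros j. unfold beta. rewrite Cmod_mult, Cmod_pow, Cmod_R, Rabs_pos_eq by lra.
    rewrite Rpow_mult_distr, <- pow_mult, (Nat.mul_comm j 2). reflexivity. }
  rewrite (sum_n_ext _ _ _ Eb) in Hle.
  eapply Rle_trans; [apply (sum_n_R_incr _ n M)|].
  - intros k. apply Rmult_le_pos; [apply pow2_ge_0 | apply pow_le; lra].
  - unfold M; lia.
  - eapply Rle_trans; [apply Hle|].
    rewrite Cmod_mult, Cmod_R, Rabs_pos_eq by lra.
    assert ((Cmod q * r) ^ 2 <= Cmod q ^ 2) by (apply pow_incr; nra). lra.
Qed.

(** The limit [r -> 1], made quantitative with [r = 1 - eps]: by Bernoulli's inequality the weights
    [r^(2 j)] cost at most [2 n eps] times the sum [B]. *)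
Lemma bessel_disk (h : C -> C) (b : nat -> C) (q : C) (n : nat) :
  taylor_on_disk h b ->
  (forall z, in_disk z -> Cmod (h z) <= Cmod (1 + q * z)%C) ->
  sum_n (fun j => Cmod (b j) ^ 2) n <= 1 + Cmod q ^ 2.
Proof.
  intros H Hq.
  set (B := sum_n (fun j => Cmod (b j) ^ 2) n).
  assert (HB : 0 <= B).
  { apply Rle_trans with (sum_n (fun j => Cmod (b j) ^ 2) 0);
      [rewrite sum_O; apply pow2_ge_0|].
    apply sum_n_R_incr; [intros; apply pow2_ge_0 | lia]. }
  pose proof (Cmod_ge_0 q) as Q0.
  (* Collects both losses, the approximation error on the circle and the weights, so that the total
     error is [eps * K]. *)
  set (K := 2 * (1 + Cmod q) + 1 + INR (2 * n) * B).
  assert (HK : 0 < K).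
  { pose proof (pos_INR (2 * n)). unfold K.
    assert (0 <= INR (2 * n) * B) by (apply Rmult_le_pos; assumption). lra. }
  apply le_epsilon. intros eps0 He0.
  set (eps := Rmin 1 (eps0 / K)).
  assert (He : 0 < eps <= 1).
  { split; [apply Rmin_pos; [lra | apply Rdiv_lt_0_compat; lra] | apply Rmin_l]. }
  assert (HeK : eps * K <= eps0).
  { apply (Rmult_le_reg_r (/ K)); [now apply Rinv_0_lt_compat|].
    rewrite Rmult_assoc, Rinv_r, Rmult_1_r by lra. apply Rmin_r. }
  pose proof (bessel_circle h b q (1 - eps) eps n H Hq ltac:(lra) He) as L.
  assert (L2 : B * (1 - INR (2 * n) * eps)
               <= sum_n (fun j => Cmod (b j) ^ 2 * (1 - eps) ^ (2 * j)) n).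
  { unfold B. clear - He.
    assert (G : forall m, (m <= n)%nat ->
      sum_n (fun j => Cmod (b j) ^ 2) m * (1 - INR (2 * n) * eps)
      <= sum_n (fun j => Cmod (b j) ^ 2 * (1 - eps) ^ (2 * j)) m).
    { assert (T : forall j, (j <= n)%nat -> Cmod (b j) ^ 2 * (1 - INR (2 * n) * eps)
         <= Cmod (b j) ^ 2 * (1 - eps) ^ (2 * j)).
      { intros j Hj. apply Rmult_le_compat_l; [apply pow2_ge_0|].
        pose proof (bernoulli_sub (1 - eps) (2 * j) ltac:(lra)) as P.
        assert (INR (2 * j) <= INR (2 * n)) by (apply le_INR; lia). nra. }
      induction m as [|m IH]; intros Hm.
      - rewrite !sum_O. now apply T.
      - rewrite !sum_n_R_S, Rmult_plus_distr_r.
        apply Rplus_le_compat; [apply IH; lia | now apply T]. }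
    apply G, le_n. }
  unfold K in HeK. nra.
Qed.

Lemma schwarz_bessel (w : C -> C) (c : nat -> C) (mu : R) :
  schwarz w -> taylor_on_disk w c ->
  Cmod (c 1%nat) ^ 2 + Cmod (c 2%nat + mu * c 1%nat * c 1%nat)%C ^ 2
  + Cmod (c 3%nat + mu * c 1%nat * c 2%nat)%C ^ 2
  <= 1 + mu ^ 2 * Cmod (c 1%nat) ^ 2.
Proof.
  intros [_ [Hw0 Hwd]] Hw.
  assert (c0 : c 0%nat = 0%C) by (rewrite <- Hw0; symmetry; now apply taylor_at_0).
  pose proof (taylor_plus _ _ _ _ Hw
    (taylor_scal (mu * c 1%nat) _ _ (taylor_incr _ _ Hw))) as H.
  (* The cutoff 3 keeps the coefficients of index 0 to 3, the zeroth being 0 because [w 0 = 0]. *)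
  pose proof (bessel_disk _ _ (mu * c 1%nat)%C 3 H) as B.
  cbv beta in B. rewrite !sum_n_R_S, sum_O in B. unfold incr in B.
  rewrite c0, Cmod_mult, Cmod_R, Rpow_mult_distr, pow2_abs in B.
  rewrite Cmult_0_r, !Cplus_0_r, Cmod_0 in B.
  refine (Rle_trans _ _ _ _ (B _)); [right; simpl; ring|].
  intros z Hz.
  replace (w z + mu * c 1%nat * (z * w z))%C
    with (w z * (1 + mu * c 1%nat * z))%C by ring.
  rewrite Cmod_mult. pose proof (Hwd z Hz) as K. unfold in_disk in K.
  pose proof (Cmod_ge_0 (1 + mu * c 1%nat * z)%C). nra.
Qed.

Lemma log_coeff_bound (f : C -> C) (a : nat -> C) :
  starlike_ch f -> taylor_on_disk f a ->
  forall n, (1 <= n <= 3)%nat -> Cmod (log_coeff a n) <= 1 / (2 * INR n).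
Proof.
  intros [HA [w [Hw Heq]]] Hf n Hn.
  pose proof Hw as [[c Hc] _].
  destruct (log_coeff_schwarz f w a c HA Hf Hw Hc Heq) as [E1 [E2 E3]].
  assert (D : forall (z : C) (k : R), 0 < k -> Cmod z ^ 2 <= 1 -> Cmod (z / k)%C <= 1 / k).
  { intros z k Hk Hz. rewrite Cmod_div by (intros F; apply RtoC_inj in F; lra).
    rewrite Cmod_R, (Rabs_pos_eq k) by lra.
    apply Rmult_le_compat_r; [left; now apply Rinv_0_lt_compat|].
    pose proof (Cmod_ge_0 z). nra. }
  destruct n as [|[|[|[|n]]]]; try lia.
  - rewrite E1. replace (2 * INR 1) with 2 by (simpl; ring). apply D; [lra|].
    pose proof (schwarz_bessel w c 0 Hw Hc) as B.
    pose proof (pow2_ge_0 (Cmod (c 2%nat + 0%R * c 1%nat * c 1%nat)%C)).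
    pose proof (pow2_ge_0 (Cmod (c 3%nat + 0%R * c 1%nat * c 2%nat)%C)). lra.
  - rewrite E2. replace (2 * INR 2) with 4 by (simpl; ring). apply D; [lra|].
    pose proof (schwarz_bessel w c (/ 2) Hw Hc) as B.
    pose proof (pow2_ge_0 (Cmod (c 3%nat + (/ 2)%R * c 1%nat * c 2%nat)%C)).
    replace (c 2%nat + c 1%nat * c 1%nat / 2)%C
      with (c 2%nat + (/ 2)%R * c 1%nat * c 1%nat)%C
      by (rewrite RtoC_inv by lra; field).
    pose proof (pow2_ge_0 (Cmod (c 1%nat))). lra.
  - rewrite E3. replace (2 * INR 3) with 6 by (simpl; ring). apply D; [lra|].
    pose proof (schwarz_bessel w c 1 Hw Hc) as B.
    pose proof (pow2_ge_0 (Cmod (c 2%nat + 1%R * c 1%nat * c 1%nat)%C)).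
    replace (c 3%nat + c 1%nat * c 2%nat)%C
      with (c 3%nat + 1%R * c 1%nat * c 2%nat)%C by ring.
    lra.
Qed.

(** * Extremal functions *)

Definition spread (n : nat) (u : nat -> C) (k : nat) : C :=
  if Nat.eq_dec (k mod n) 0 then u (k / n)%nat else 0%C.

(** Partial sums change only at multiples of [n], so those of the spread sequence repeat those of
    [u]. Composition with [z^n] thus needs no rearrangement of series. *)
Lemma Csum_spread (n : nat) (u : nat -> C) (K : nat) :
  (0 < n)%nat -> Csum (spread n u) K = Csum u (K / n).
Proof.
  intros Hn. induction K as [|K IH].
  - rewrite Nat.Div0.div_0_l, !Csum_0. unfold spread.
    rewrite Nat.Div0.mod_0_l, Nat.Div0.div_0_l. reflexivity.
  - rewrite Csum_S, IH. unfold spread.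
    pose proof (Nat.div_mod_eq K n) as E1. pose proof (Nat.mod_upper_bound K n ltac:(lia)) as U1.
    pose proof (Nat.div_mod_eq (S K) n) as E2.
    pose proof (Nat.mod_upper_bound (S K) n ltac:(lia)) as U2.
    destruct (Nat.eq_dec (S K mod n) 0) as [Z|Z].
    + assert (E : (S K / n = S (K / n))%nat) by nia. now rewrite E, Csum_S.
    + assert (E : (S K / n = K / n)%nat) by nia. rewrite E. ring.
Qed.

Lemma taylor_comp_pow (n : nat) (f : C -> C) (a : nat -> C) :
  (0 < n)%nat -> taylor_on_disk f a ->
  taylor_on_disk (fun z => f (z ^ n)%C) (spread n a).
Proof.
  rewrite !taylor_csum. intros Hn H z Hz.
  assert (Hzn : in_disk (z ^ n)%C).
  { unfold in_disk in *. rewrite Cmod_pow. pose proof (Cmod_ge_0 z).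
    apply pow_lt_1_compat; [lra | exact Hn]. }
  apply (csum_ext (spread n (fun k => a k * (z ^ n) ^ k)%C)).
  { intros k. unfold spread. destruct (Nat.eq_dec (k mod n) 0) as [Z|Z]; [|ring].
    rewrite <- Cpow_mult_r. do 2 f_equal.
    rewrite (Nat.div_mod_eq k n) at 2. lia. }
  apply csum_eps. intros eps He.
  destruct (proj1 (csum_eps _ _) (H _ Hzn) eps He) as [N HN].
  exists (N * n)%nat. intros k Hk.
  rewrite Csum_spread by exact Hn. apply HN.
  apply Nat.div_le_lower_bound; lia.
Qed.

Fixpoint pow_coef (n : nat) : nat -> C :=
  match n with
  | O => fun k => match k with O => 1%C | _ => 0%C end
  | S m => incr (pow_coef m)
  end.

Lemma taylor_pow (n : nat) : taylor_on_disk (fun z => z ^ n)%C (pow_coef n).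
Proof. induction n as [|n IH]; [apply taylor_one | apply (taylor_incr _ _ IH)]. Qed.

(** * Coefficients of the exponential of a primitive *)

Lemma Cmod_Csum_le_count (u : nat -> C) (n : nat) :
  (forall k, (k <= n)%nat -> Cmod (u k) <= 1) -> Cmod (Csum u n) <= INR (S n).
Proof.
  induction n as [|n IH]; intros H.
  - rewrite Csum_0. simpl. apply H. lia.
  - rewrite Csum_S, S_INR. eapply Rle_trans; [apply Cmod_triangle|].
    apply Rplus_le_compat; [apply IH; intros; apply H; lia | apply H; lia].
Qed.

Lemma conv_ext_le (a b b' : nat -> C) (n : nat) :
  (forall k, (k <= n)%nat -> b k = b' k) -> conv a b n = conv a b' n.
Proof.
  intros H. apply (sum_n_ext_loc (G := C_AbelianMonoid)). intros k Hk.
  rewrite H by lia. reflexivity.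
Qed.

(* Table of the coefficients of [exp (int g)] up to index [k]; entries beyond
   [k] are meaningless. *)
Fixpoint exp_int_table (g : nat -> C) (k : nat) : nat -> C :=
  match k with
  | O => fun _ => 1%C
  | S m => fun j => if le_dec j m then exp_int_table g m j
                    else (conv g (exp_int_table g m) m / INR (S m))%C
  end.

(** The diagonal of the table realizes a course-of-values recursion, each coefficient being a
    convolution with all earlier ones. *)
Definition exp_int_coef (g : nat -> C) (k : nat) : C := exp_int_table g k k.

Lemma exp_int_table_stable (g : nat -> C) (k j : nat) :
  (j <= k)%nat -> exp_int_table g k j = exp_int_coef g j.
Proof.
  intros H. induction H as [|k H IH]; [reflexivity|].
  simpl. destruct (le_dec j k); [exact IH | lia].
Qed.

Lemma exp_int_coef_S (g : nat -> C) (k : nat) :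
  exp_int_coef g (S k) = (conv g (exp_int_coef g) k / INR (S k))%C.
Proof.
  unfold exp_int_coef at 1. cbn [exp_int_table].
  destruct (le_dec (S k) k); [lia|]. f_equal.
  apply conv_ext_le. intros j Hj. now apply exp_int_table_stable.
Qed.

Lemma INR_S_nz (k : nat) : RtoC (INR (S k)) <> 0%C.
Proof. intros F. apply RtoC_inj in F. revert F. apply not_0_INR. lia. Qed.

(* The majorant of [exp (int g)] is [exp (- log (1 - z)) = 1 / (1 - z)]. *)
Lemma exp_int_coef_le_1 (g : nat -> C) :
  (forall k, Cmod (g k) <= 1) -> forall k, Cmod (exp_int_coef g k) <= 1.
Proof.
  intros Hg k. induction k as [k IH] using (well_founded_induction lt_wf).
  destruct k as [|k]; [unfold exp_int_coef; simpl; rewrite Cmod_1; lra|].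
  rewrite exp_int_coef_S, Cmod_div by apply INR_S_nz.
  assert (P : 0 < INR (S k)) by (apply lt_0_INR; lia).
  rewrite Cmod_R, (Rabs_pos_eq (INR (S k))) by lra.
  apply (Rmult_le_reg_r (INR (S k))); [exact P|].
  unfold Rdiv. rewrite Rmult_assoc, Rinv_l, Rmult_1_r, Rmult_1_l by lra.
  apply Cmod_Csum_le_count. intros j Hj. rewrite Cmod_mult.
  pose proof (Hg j). pose proof (IH (k - j)%nat ltac:(lia)).
  pose proof (Cmod_ge_0 (g j)). pose proof (Cmod_ge_0 (exp_int_coef g (k - j))). nra.
Qed.

(** Let [E] and [G] be the sums of the candidate series and of the formal primitive of [g]. Termwise
    differentiation gives [E' = g E] and [G' = g], hence [E = exp G], and [G z] is the segment
    integral by the fundamental theorem. *)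
Lemma taylor_exp_int (g : C -> C) (b : nat -> C) :
  taylor_on_disk g b -> (forall k, Cmod (b k) <= 1) ->
  taylor_on_disk
    (fun z => cexp (@RInt C_R_CompleteNormedModule (fun s : R => g (s * z) * z)%C 0 1))
    (exp_int_coef b).
Proof.
  intros Hg Hb.
  destruct (taylor_exists (exp_int_coef b) (exp_int_coef_le_1 b Hb)) as [E HE].
  destruct (taylor_exists (incr (fun k => b k / INR (S k))%C)) as [G HG].
  { intros [|k]; cbn [incr]; [rewrite Cmod_0; lra|].
    rewrite Cmod_div by apply INR_S_nz.
    assert (P : 1 <= INR (S k)) by (apply (le_INR 1); lia).
    rewrite Cmod_R, (Rabs_pos_eq (INR (S k))) by lra.
    apply (Rmult_le_reg_r (INR (S k))); [lra|].
    unfold Rdiv. rewrite Rmult_assoc, Rinv_l, Rmult_1_r, Rmult_1_l by lra.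
    pose proof (Hb k). lra. }
  destruct (taylor_derive E _ HE) as [HE' DE]. destruct (taylor_derive G _ HG) as [HG' DG].
  assert (EE : forall z, in_disk z -> C_derive E z = (g z * E z)%C).
  { intros z Hz. apply (taylor_fun_unique _ (fun z => g z * E z)%C _ z HE'); [|exact Hz].
    refine (taylor_ext _ _ _ _ _ _ (taylor_mult _ _ _ _ Hg HE)); [reflexivity|].
    intros k. rewrite exp_int_coef_S. field. apply INR_S_nz. }
  assert (EG : forall z, in_disk z -> C_derive G z = g z).
  { intros z Hz. apply (taylor_fun_unique _ _ _ z HG'); [|exact Hz].
    refine (taylor_ext _ _ _ _ _ _ Hg); [reflexivity|].
    intros k. cbn [incr]. field. apply INR_S_nz. }
  assert (G0 : G 0%C = 0%C) by exact (taylor_at_0 _ _ HG).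
  refine (taylor_ext _ _ _ _ _ (fun k => eq_refl) HE).
  intros z Hz.
  rewrite (log_derivative_exp E G g); [| | | |exact Hz].
  - f_equal. symmetry. apply (is_RInt_unique (V := C_R_CompleteNormedModule)).
    replace (G z) with (G z - G 0)%C by (rewrite G0; ring).
    apply is_RInt_segment; intros s Hs; pose proof (in_disk_segment s z Hs Hz) as Hsz.
    + rewrite <- EG by exact Hsz. now apply DG.
    + eexists. apply (proj2 (taylor_derive g b Hg)), Hsz.
  - intros v Hv. rewrite <- EE by exact Hv. now apply DE.
  - intros v Hv. rewrite <- EG by exact Hv. now apply DG.
  - rewrite G0, cexp_0. exact (taylor_at_0 _ _ HE).
Qed.

(** [g] is the analytic completion at 0 of the quotient [g_ext n]; replacing one by the other under
    the integral makes the series for exponentials of primitives available. *)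
Lemma f_ext_taylor (n : nat) :
  (0 < n)%nat ->
  exists (g : C -> C) (b : nat -> C),
    taylor_on_disk g b /\
    (forall z, in_disk z -> phi0 (z ^ n) = (1 + z * g z)%C) /\
    taylor_on_disk (f_ext n) (incr (exp_int_coef b)).
Proof.
  intros Hn.
  pose proof (taylor_comp_pow n _ _ Hn taylor_phi0) as HP.
  destruct (taylor_split _ _ HP) as [g [Hg Eg]].
  exists g. eexists. split; [exact Hg|].
  assert (E1 : forall z, in_disk z -> phi0 (z ^ n) = (1 + z * g z)%C).
  { intros z Hz. rewrite (Eg z Hz). f_equal. unfold spread.
    rewrite Nat.Div0.mod_0_l, Nat.Div0.div_0_l. simpl. f_equal. field. }
  split; [exact E1|].
  assert (Hb : forall k, Cmod (spread n phi0_coef (S k)) <= 1).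
  { intros k. unfold spread. destruct (Nat.eq_dec _ _); [apply phi0_coef_le_1|].
    rewrite Cmod_0; lra. }
  refine (taylor_ext _ _ _ _ _ (fun k => eq_refl)
    (taylor_incr _ _ (taylor_exp_int g _ Hg Hb))).
  intros z Hz. unfold f_ext, seg_int. do 2 f_equal.
  apply (RInt_ext (V := C_R_CompleteNormedModule)).
  (* The integrands are compared on the open interval [0 < s < 1], which avoids the quotient at 0;
     for [z = 0] the factor [z] makes both vanish. *)
  rewrite Rmin_left, Rmax_right by lra. intros s Hs.
  destruct (Req_EM_T (Cmod z) 0) as [Z|Z].
  - apply Cmod_eq_0 in Z. subst z. now rewrite !Cmult_0_r.
  - assert (Hz0 : z <> 0%C) by (intros K; subst z; apply Z, Cmod_0).
    assert (Hs0 : RtoC s <> 0%C) by (intros K; apply RtoC_inj in K; lra).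
    pose proof (E1 _ (in_disk_segment s z ltac:(lra) Hz)) as E.
    f_equal. unfold g_ext. unfold phi0 in E. rewrite E. field. split; assumption.
Qed.

Lemma schwarz_pow (n : nat) : (0 < n)%nat -> schwarz (fun z => z ^ n)%C.
Proof.
  intros Hn. split; [exists (pow_coef n); apply taylor_pow|]. split.
  - destruct n; [lia|]. rewrite Cpow_S. ring.
  - intros z Hz. unfold in_disk in *. rewrite Cmod_pow. pose proof (Cmod_ge_0 z).
    apply pow_lt_1_compat; [lra | exact Hn].
Qed.

Lemma f_ext_extremal (n : nat) :
  (0 < n)%nat ->
  classA (f_ext n) /\
  forall z : C, in_disk z -> z <> 0%C ->
    f_ext n z <> 0%C /\
    exists d : C, is_cderiv (f_ext n) z d /\ (z * d / f_ext n z)%C = phi0 (z ^ n).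
Proof.
  intros Hn. destruct (f_ext_taylor n Hn) as [g [b [Hg [Eg Hf]]]].
  destruct (taylor_derive _ _ Hf) as [Hf' Df].
  split.
  - split; [exists (incr (exp_int_coef b)); exact Hf|]. split.
    + exact (taylor_at_0 _ _ Hf).
    + assert (D0 : in_disk 0) by (unfold in_disk; rewrite Cmod_0; lra).
      pose proof (Df _ D0) as D. rewrite (taylor_at_0 _ _ Hf') in D.
      replace (RtoC 1) with (INR 1 * incr (exp_int_coef b) 1)%C; [exact D|].
      simpl. unfold exp_int_coef. simpl. ring.
  - intros z Hz Hz0. set (F := cexp (seg_int (g_ext n) z)).
    assert (HF : F <> 0%C) by apply cexp_nz.
    assert (E : f_ext n z = (z * F)%C) by reflexivity.
    split; [rewrite E; now apply Cmult_neq_0|].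
    exists (C_derive (f_ext n) z). split; [now apply Df|].
    assert (EF : (z * C_derive (f_ext n) z)%C = (f_ext n z * phi0 (z ^ n))%C).
    { rewrite (Eg z Hz).
      replace (f_ext n z * (1 + z * g z))%C
        with (f_ext n z + z * (g z * f_ext n z))%C by ring.
      apply (taylor_fun_unique _ (fun z => f_ext n z + z * (g z * f_ext n z))%C _ z
               (taylor_zderive _ _ Hf)); [|exact Hz].
      (* Writing [f = z h] turns the right side into [f + z^2 g h]. At index [k + 2] the identity
         then reads [(k + 2) e_(k+1) = e_(k+1) + conv b e k], which is the recurrence for [e]. *)
      destruct (taylor_split _ _ Hf) as [h [Hh Eh]].
      refine (taylor_ext _ _ _ _ _ _ (taylor_plus _ _ _ _ Hf
        (taylor_incr _ _ (taylor_incr _ _ (taylor_mult _ _ _ _ Hg Hh))))).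
      - intros v Hv. rewrite (Eh v Hv). cbn [incr]. ring.
      - intros [|[|k]]; [simpl; ring | simpl; ring |].
        cbn [incr]. rewrite (S_INR (S k)), RtoC_plus.
        rewrite exp_int_coef_S.
        transitivity ((conv b (exp_int_coef b) k / INR (S k)) + conv b (exp_int_coef b) k)%C;
          [f_equal|]. field. apply INR_S_nz. }
    rewrite EF. rewrite E. field. split; assumption.
Qed.

Theorem theorem2p1 :
  (forall (f : C -> C) (a : nat -> C),
     starlike_ch f -> taylor_on_disk f a ->
     forall n : nat, (1 <= n <= 3)%nat ->
       Cmod (log_coeff a n) <= 1 / (2 * INR n))
  /\
  (forall n : nat, (1 <= n <= 3)%nat ->
     starlike_ch (f_ext n) /\
     forall a : nat -> C, taylor_on_disk (f_ext n) a ->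
       Cmod (log_coeff a n) = 1 / (2 * INR n)).
Proof.
  split; [exact log_coeff_bound|].
  intros n Hn. destruct (f_ext_extremal n ltac:(lia)) as [HA Heq].
  assert (HS := schwarz_pow n ltac:(lia)).
  split; [split; [exact HA | exists (fun z => z ^ n)%C; split; [exact HS | exact Heq]]|].
  intros a Ha.
  (* For [w = z^n] the coefficient of index [n] is 1 and all others are 0, so the formula for the
     [n]-th logarithmic coefficient collapses to [1 / (2 n)]. *)
  destruct (log_coeff_schwarz _ _ _ _ HA Ha HS (taylor_pow n) Heq) as [E1 [E2 E3]].
  assert (D : forall k : R, 0 < k -> Cmod (1 / k)%C = 1 / k).
  { intros k Hk. rewrite <- RtoC_div by lra. rewrite Cmod_R. apply Rabs_pos_eq.
    unfold Rdiv. rewrite Rmult_1_l. left. now apply Rinv_0_lt_compat. }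
  destruct n as [|[|[|[|n]]]]; try lia.
  - rewrite E1. replace (2 * INR 1) with 2 by (simpl; ring).
    etransitivity; [|apply (D 2); lra]. f_equal.
  - rewrite E2. replace (2 * INR 2) with 4 by (simpl; ring).
    etransitivity; [|apply (D 4); lra]. f_equal. simpl. field.
  - rewrite E3. replace (2 * INR 3) with 6 by (simpl; ring).
    etransitivity; [|apply (D 6); lra]. f_equal. simpl. field.
Qed.
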